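(* Let $f:X\to X$ be a continuous map on a complete metric space $(X,d)$, let $\overline{f}:\mathcal{K}(X)\to\mathcal{K}(X)$ be the induced map on the hyperspace of non-empty compact subsets of $X$, and let $\hat{f}$ be the Zadeh extension of $f$ to the space $\mathcal{F}(X)$ of normal fuzzy sets, where $\mathcal{F}_\infty(X)=(\mathcal{F}(X),d_\infty)$ and $\mathcal{F}_0(X)=(\mathcal{F}(X),d_0)$ denote this space with the supremum metric and with the Skorokhod metric, respectively. Then: (a) The following statements are equivalent: (i) $f_{(N)}:X^N\to X^N$ is point-recurrent for every $N \in \mathbb{N}$; (ii) $\overline{f}:\mathcal{K}(X)\to \mathcal{K}(X)$ is point-recurrent; (iii) $\hat{f}:\mathcal{F}_{\infty}(X)\to \mathcal{F}_{\infty}(X)$ is point-recurrent; (iv) $\hat{f}:\mathcal{F}_{0}(X)\to \mathcal{F}_{0}(X)$ is point-recurrent. (b) The following statements are equivalent: (i) $f_{(N)}:X^N\to X^N$ is $\mathcal{AP}$-recurrent for every $N \in \mathbb{N}$; (ii) $\overline{f}:\mathcal{K}(X)\to \mathcal{K}(X)$ is $\mathcal{AP}$-recurrent; (iii) $\hat{f}:\mathcal{F}_{\infty}(X)\to \mathcal{F}_{\infty}(X)$ is $\mathcal{AP}$-recurrent; (iv) $\hat{f}:\mathcal{F}_{0}(X)\to \mathcal{F}_{0}(X)$ is $\mathcal{AP}$-recurrent.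
   Context: $\mathbb{N}$ is the set of strictly positive integers and $\mathbb{N}_0=\mathbb{N}\cup\{0\}$. For a continuous self-map $g:Y\to Y$ of a topological space $Y$ and $N\in\mathbb{N}$, $g_{(N)}:Y^N\to Y^N$ denotes the $N$-fold direct product $g_{(N)}(y_1,\dots,y_N)=(g(y_1),\dots,g(y_N))$, where $Y^N$ carries the product topology. Let $g:Y\to Y$ be a continuous self-map of a topological space $Y$. For $y\in Y$ and $U\subset Y$ put $\mathcal{N}_g(y,U):=\{n\in\mathbb{N}_0\;;\;g^n(y)\in U\}$. - A point $y\in Y$ is recurrent for $g$ if for every neighbourhood $U$ of $y$ the set $\mathcal{N}_g(y,U)$ is infinite. The map $g$ is point-recurrent if its set of recurrent points is dense in $Y$. - A point $y\in Y$ is $\mathcal{AP}$-recurrent for $g$ if for every neighbourhood $U$ of $y$ the set $\mathcal{N}_g(y,U)$ contains arbitrarily long arithmetic progressions, i.e. for each $\ell\in\mathbb{N}$ there exist $n\in\mathbb{N}$ and $n_0\in\mathbb{N}_0$ such that $\{n_0+jn\;;\;0\le j\le\ell\}\subset\mathcal{N}_g(y,U)$. The map $g$ is $\mathcal{AP}$-recurrent if its set of $\mathcal{AP}$-recurrent points is dense in $Y$. $\mathcal{K}(X)$ is the set of all non-empty compact subsets of $X$, endowed with the Vietoris topology, whose basic open sets are $\mathcal{V}(U_1,\dots,U_N)=\{K\in\mathcal{K}(X)\;;\;K\subset\bigcup_{j=1}^N U_j,\ K\cap U_j\neq\varnothing \text{ for all } 1\le j\le N\}$ with $N\in\mathbb{N}$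 and $U_1,\dots,U_N\subset X$ non-empty open; for a metric space $(X,d)$ this is the topology of the Hausdorff metric $d_H(K_1,K_2)=\max\{\max_{x_1\in K_1}d(x_1,K_2),\max_{x_2\in K_2}d(x_2,K_1)\}$. The map $\overline{f}:\mathcal{K}(X)\to\mathcal{K}(X)$ is $\overline{f}(K):=f(K)$. Fuzzy sets: for a function $u:X\to[0,1]$ put $u_\alpha:=\{x\in X\;;\;u(x)\ge\alpha\}$ for $\alpha\in(0,1]$ and $u_0:=\overline{\{x\in X\;;\;u(x)>0\}}$ (closure in $X$). $\mathcal{F}(X)$ is the set of normal fuzzy sets: the upper-semicontinuous functions $u:X\to[0,1]$ such that $u_0$ is compact and $u_1$ is non-empty. Zadeh extension: $\hat{f}(u)(x):=\sup\{u(y)\;;\;y\in f^{-1}(x)\}$ if $f^{-1}(x)\neq\varnothing$, and $\hat{f}(u)(x):=0$ if $f^{-1}(x)=\varnothing$. For continuous $f$ on a metric space, $\hat f$ is a well-defined self-map of $\mathcal{F}(X)$, continuous for both metrics below. Supremum metric: $d_\infty(u,v):=\sup_{\alpha\in[0,1]}d_H(u_\alpha,v_\alpha)$ for $u,v\in\mathcal{F}(X)$. Skorokhod metric: $d_0(u,v):=\inf\{\varepsilon\;;\;\text{there is }\xi\in\mathcal{T}\text{ with }\sup_{\alpha\in[0,1]}|\xi(\alpha)-\alpha|\le\varepsilon\text{ and }d_\infty(u,\xi\circ v)\le\varepsilon\}$, where $\mathcal{T}$ is the set of strictly increasing homeomorphisms $\xi:[0,1]\to[0,1]$. *)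

(* Defs.v *)
From HB Require Import structures.
From mathcomp Require Import all_boot all_order all_algebra.
From mathcomp Require Import all_classical all_reals all_analysis.
From mathcomp Require Import lra.

Set Implicit Arguments.
Unset Strict Implicit.
Unset Printing Implicit Defensive.

Import Order.TTheory GRing.Theory Num.Theory.
Import numFieldNormedType.Exports.

Local Open Scope classical_set_scope.
Local Open Scope ring_scope.

(* The library's [completeType] is pointed, which would exclude the empty
   space; hence completeness is a predicate. *)
Definition complete_space (X : uniformType) :=
  forall x : nat -> X, cauchy (x @ \oo) -> exists l : X, x @ \oo --> l.

Section recurrence.
Variable Y : topologicalType.
Implicit Types (g : Y -> Y) (y : Y) (U : set Y).

Definition return_set g y U : set nat := [set n | U (iter n g y)].

Definition recurrent_point g y :=
  forall U, nbhs y U -> infinite_set (return_set g y U).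

Definition point_recurrent g := dense [set y | recurrent_point g y].

Definition AP_recurrent_point g y :=
  forall U, nbhs y U -> forall l : nat, (0 < l)%N ->
    exists n n0 : nat, (0 < n)%N /\
      forall j : nat, (j <= l)%N -> return_set g y U (n0 + j * n)%N.

Definition AP_recurrent g := dense [set y | AP_recurrent_point g y].

End recurrence.
Arguments point_recurrent Y g : clear implicits.
Arguments AP_recurrent Y g : clear implicits.

Definition direct_product (Y : topologicalType) (g : Y -> Y) (N : nat)
    (y : {ptws 'I_N -> Y}) : {ptws 'I_N -> Y} :=
  fun i => g (y i).

Section hyperspace.
Variable X : topologicalType.

Record hyperspace := Hyperspace {
  hset :> set X ;
  hset_compact : compact hset ;
  hset_neq0 : hset !=set0 }.

HB.instance Definition _ := gen_eqMixin hyperspace.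
HB.instance Definition _ := gen_choiceMixin hyperspace.

(* V(U_1, ..., U_N) depends only on the set Us = {U_1, ..., U_N}. *)
Definition vietoris_index : set (set (set X)) :=
  [set Us | [/\ finite_set Us, Us !=set0 &
                forall U, Us U -> open U /\ U !=set0]].

Definition vietoris (Us : set (set X)) : set hyperspace :=
  [set K | K `<=` \bigcup_(U in Us) U /\
           forall U, Us U -> (K : set X) `&` U !=set0].

Let vietoris_cover : \bigcup_(Us in vietoris_index) vietoris Us = setT.
Proof.
apply/seteqP; split => // K _; have [x Kx] := hset_neq0 K.
exists [set setT]; first split.
- exact: finite_set1.
- by exists setT.
- by move=> _ ->; split; [exact: openT|exists x].
split; first by move=> y _; exists setT.
by move=> _ ->; exists x.
Qed.

Let vietoris_join Us Vs K : vietoris_index Us -> vietoris_index Vs ->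
  vietoris Us K -> vietoris Vs K ->
  exists Ws, [/\ vietoris_index Ws, vietoris Ws K &
    vietoris Ws `<=` vietoris Us `&` vietoris Vs].
Proof.
move=> [fU [U0 U0U] oU] [fV _ oV] [KU KUi] [KV KVi].
pose A := \bigcup_(U in Us) U; pose B := \bigcup_(V in Vs) V.
have oA : open A by apply: bigcup_open => U /oU[].
have oB : open B by apply: bigcup_open => U /oV[].
pose Ws := ((fun U => U `&` B) @` Us) `|` ((fun V => V `&` A) @` Vs).
have KWi W : Ws W -> (K : set X) `&` W !=set0.
  move=> [[U /KUi[x [Kx Ux]] <-]|[V /KVi[x [Kx Vx]] <-]].
    by exists x; do !split => //; exact: KV.
  by exists x; do !split => //; exact: KU.
exists Ws; split.
- split.
  + by rewrite finite_setU; split; exact: finite_image.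
  + by exists (U0 `&` B); left; exists U0.
  + move=> W WsW; split; last by have [x [_ Wx]] := KWi _ WsW; exists x.
    by case: WsW => -[U /= + <-] => [/oU|/oV] [oU' _]; exact: openI.
- split=> // x Kx; have [U UsU Ux] := KU _ Kx.
  by exists (U `&` B); [left; exists U|split=> //; exact: KV].
- move=> L [LW LWi]; split; split.
  + by move=> x /LW[W [[U UsU <-] [Ux _]|[V _ <-] [_ //]]]; exists U.
  + move=> U UsU; have [|x [Lx [Ux _]]] := LWi (U `&` B); last by exists x.
    by left; exists U.
  + by move=> x /LW[W [[U _ <-] [_ //]|[V VsV <-] [Vx _]]]; exists V.
  + move=> V VsV; have [|x [Lx [Vx _]]] := LWi (V `&` A); last by exists x.
    by right; exists V.
Qed.

HB.instance Definition _ := isBaseTopological.Build hyperspace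
  vietoris_cover vietoris_join.

End hyperspace.

Definition hyper_map (X : topologicalType) (f : X -> X) (cf : continuous f)
    (K : hyperspace X) : hyperspace X :=
  Hyperspace
    (continuous_compact (continuous_subspaceT cf) (hset_compact (h := K)))
    (image_nonempty f (hset_neq0 K)).

Section fuzzy_sets.
Variables (R : realType) (X : metricType R).
Implicit Types (u v w : X -> R) (A B C : set X) (x y : X).

Definition upper_semicontinuous u :=
  forall x (a : R), u x < a -> \forall y \near x, u y < a.

Definition level u (a : R) : set X :=
  if a == 0 then closure [set x | 0 < u x] else [set x | a <= u x].

Record fuzzy := Fuzzy {
  fuzzy_fun :> X -> R ;
  fuzzy_itv : forall x, 0 <= fuzzy_fun x <= 1 ;
  fuzzy_usc : upper_semicontinuous fuzzy_fun ;
  fuzzy_compact : compact (level fuzzy_fun 0) ;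
  fuzzy_normal : level fuzzy_fun 1 !=set0 }.

HB.instance Definition _ := gen_eqMixin fuzzy.
HB.instance Definition _ := gen_choiceMixin fuzzy.

Definition zadeh_fun (f : X -> X) u : X -> R := fun x =>
  if `[< f @^-1` [set x] !=set0 >] then sup (u @` (f @^-1` [set x])) else 0.

(* On non-empty compact sets the infima and suprema below are attained, as
   they are minima and maxima in the definition of the Hausdorff metric. *)
Definition set_dist x A : R := inf [set mdist x a | a in A].

Definition hausdorff_dist A B : R :=
  Num.max (sup [set set_dist x B | x in A]) (sup [set set_dist x A | x in B]).

Definition sup_dist u v : R :=
  sup [set hausdorff_dist (level u a) (level v a) | a in `[0, 1]%classic].

(* Only the values of xi on [0, 1] matter. *)
Definition increasing_homeo (xi : R -> R) :=
  exists zeta : R -> R,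
  [/\ set_fun `[0, 1]%classic `[0, 1]%classic xi
        /\ set_fun `[0, 1]%classic `[0, 1]%classic zeta,
      {in `[0, 1], cancel xi zeta} /\ {in `[0, 1], cancel zeta xi},
      {within `[0, 1]%classic, continuous xi}
        /\ {within `[0, 1]%classic, continuous zeta} &
      {in `[0, 1] &, {homo xi : a b / a < b}}].

Definition skorokhod_dist u v : R :=
  inf [set e | exists xi, [/\ increasing_homeo xi,
    sup [set `|xi a - a| | a in `[0, 1]%classic] <= e &
    sup_dist u (xi \o v) <= e]].

Lemma fuzzy_ge0 (u : fuzzy) x : 0 <= u x.
Proof. by case/andP: (fuzzy_itv u x). Qed.

Lemma fuzzy_le1 (u : fuzzy) x : u x <= 1.
Proof. by case/andP: (fuzzy_itv u x). Qed.

Lemma fuzzy_eq (u v : fuzzy) : (u : X -> R) =1 v -> u = v.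
Proof.
case: u v => [u u1 u2 u3 u4] [v v1 v2 v3 v4] /= /funext uv.
by subst v; congr Fuzzy; exact: Prop_irrelevance.
Qed.

Lemma level_sub0 u a : 0 <= a -> level u a `<=` level u 0.
Proof.
rewrite /level eqxx le_eqVlt => /predU1P[<-|a0]; first by rewrite eqxx.
by rewrite (gt_eqF a0) => x ax; apply: subset_closure; exact: lt_le_trans ax.
Qed.

Lemma fuzzy_level_neq0 (u : fuzzy) a : 0 <= a <= 1 -> level u a !=set0.
Proof.
move=> /andP[a0 a1]; have [x] := fuzzy_normal u.
rewrite /level oner_eq0 /= => ux; exists x; case: ifPn => _.
  by apply: subset_closure; exact: lt_le_trans ux.
by rewrite /= (le_trans a1).
Qed.

Lemma fuzzy_level_compact (u : fuzzy) a : 0 <= a -> compact (level u a).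
Proof.
move=> a0.
apply: (subclosed_compact _ (@fuzzy_compact u) (@level_sub0 u a a0)).
rewrite /level; case: ifPn => _; first exact: closed_closure.
rewrite -openC (_ : ~` _ = [set x | u x < a]); last first.
  by apply/seteqP; split => x /=; rewrite ltNge => /negP.
by rewrite openE => x /=; exact: fuzzy_usc.
Qed.

Section zadeh.
Variables (f : X -> X) (cf : continuous f).

Lemma zadeh_le (u : fuzzy) x : u x <= zadeh_fun f u (f x).
Proof.
rewrite /zadeh_fun; case: asboolP => [_|]; last by case; exists x.
by apply: ub_le_sup; [exists 1 => _ [z _ <-]; exact: fuzzy_le1|exists x].
Qed.

Let zadeh_itv (u : fuzzy) y : 0 <= zadeh_fun f u y <= 1.
Proof.
have [[x <-]|nx] := pselect (f @^-1` [set y] !=set0); last first.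
  by rewrite /zadeh_fun; case: asboolP; rewrite // lexx ler01.
rewrite (le_trans (fuzzy_ge0 u x) (zadeh_le u x)) /= /zadeh_fun.
case: asboolP => [_|]; last by rewrite ler01.
by apply: ge_sup; [exists (u x), x|move=> _ [z _ <-]; exact: fuzzy_le1].
Qed.

Lemma zadeh_ge (u : fuzzy) a y : 0 < a ->
  a <= zadeh_fun f u y <-> exists2 x, f x = y & a <= u x.
Proof.
move=> a0; split=> [|[x <- ax]]; last exact: le_trans (zadeh_le u x).
rewrite /zadeh_fun; case: asboolP => [[x0 fx0] ay|_]; last by rewrite leNgt a0.
apply: contrapT => nx.
have ua x : f x = y -> u x < a.
  by move=> fx; rewrite ltNge; apply/negP => ?; apply: nx; exists x.
have near0 : \forall e \near 0^'+, level u 0 `<=` [set x | f x = y -> u x <= a - e].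
  have /compact_near_coveringP := @fuzzy_compact u; apply => x _.
  have [fxy|fxy] := pselect (f x = y).
    have uxa := ua _ fxy.
    pose c := (u x + a) / 2.
    have [uc ca] : u x < c /\ c < a by rewrite midf_lt// midf_lt.
    exists ([set z | u z < c], [set e | e <= a - c]) => /=.
      split; first exact: fuzzy_usc.
      by apply: nbhs_right_le; rewrite subr_gt0.
    by case=> z e /= [zc ec] _; apply: (le_trans (ltW zc)); rewrite lerBrDl -lerBrDr.
  exists ([set z | f z != y], setT) => /=.
    split; last exact: filterT.
    suff : nbhs (f x) [set z | z != y] by exact: cf.
    apply: open_nbhs_nbhs; split; last by apply/eqP.
    rewrite -closedC (_ : ~` _ = [set y]).
      exact: (accessible_closed_set1 (hausdorff_accessible (@metric_hausdorff _ X))).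
    by apply/seteqP; split => z /=; [move/negP/negPn/eqP|move=> ->; rewrite eqxx].
  by case=> z e /= [/eqP].
have [e [/= ea e0 He]] : exists e, [/\ e <= a, 0 < e &
    level u 0 `<=` [set x | f x = y -> u x <= a - e]].
  near (0 : R)^'+ => e; exists e; split; near: e => //; first exact: nbhs_right_le.
  exact: nbhs_right_gt.
have : sup (u @` (f @^-1` [set y])) <= a - e.
  apply: ge_sup; first by exists (u x0), x0.
  move=> _ [x fx <-]; have [ux0|ux0] := ltP 0 (u x).
    apply: He => //; rewrite /level eqxx; exact: subset_closure.
  by rewrite (le_trans ux0)// subr_ge0.
by move/(le_trans ay); rewrite leNgt ltrBlDr ltrDl e0.
Unshelve. all: by end_near. Qed.

Lemma zadeh_level (u : fuzzy) a : 0 < a ->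
  level (zadeh_fun f u) a = f @` level u a.
Proof.
move=> a0; rewrite /level (gt_eqF a0); apply/seteqP; split => y.
  by move/(zadeh_ge _ _ a0) => [x fx ax]; exists x.
by move=> [x ax fx]; apply/(zadeh_ge _ _ a0); exists x.
Qed.

Let image_closed (u : fuzzy) a : 0 <= a -> closed (f @` level u a).
Proof.
move=> a0; apply: (compact_closed (@metric_hausdorff _ X)).
apply: continuous_compact; first exact: continuous_subspaceT.
exact: fuzzy_level_compact.
Qed.

Let zadeh_usc (u : fuzzy) : upper_semicontinuous (zadeh_fun f u).
Proof.
move=> y a ya; have a0 : 0 < a.
  by apply: le_lt_trans ya; case/andP: (zadeh_itv u y).
have : nbhs y (~` (f @` level u a)).
  apply: open_nbhs_nbhs; split; first by rewrite openC; exact/image_closed/ltW.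
  by rewrite -zadeh_level// /level (gt_eqF a0) /=; apply/negP; rewrite -ltNge.
apply: filterS => z; rewrite -zadeh_level// /level (gt_eqF a0) /= => /negP.
by rewrite -ltNge.
Qed.

Let zadeh_compact (u : fuzzy) : compact (level (zadeh_fun f u) 0).
Proof.
have cfu : compact (f @` level u 0).
  apply: continuous_compact; first exact: continuous_subspaceT.
  exact: fuzzy_compact.
apply: (subclosed_compact _ cfu).
  by rewrite /level eqxx; exact: closed_closure.
rewrite {1}/level eqxx.
rewrite [X in _ `<=` X](_ : _ = closure (f @` level u 0)); last first.
  by apply/closure_id; exact: image_closed.
apply: closureS => y /= y0; have [x fx ux] := (zadeh_ge u y y0).1 (lexx _).
exists x => //; rewrite /level eqxx; apply: subset_closure => /=.
exact: lt_le_trans ux.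
Qed.

Let zadeh_normal (u : fuzzy) : level (zadeh_fun f u) 1 !=set0.
Proof. by rewrite zadeh_level//; exact/image_nonempty/fuzzy_normal. Qed.

Definition zadeh (u : fuzzy) : fuzzy :=
  Fuzzy (zadeh_itv u) (@zadeh_usc u) (@zadeh_compact u) (zadeh_normal u).

End zadeh.

Definition bounded_diam A := exists M, forall x y, A x -> A y -> mdist x y <= M.

Lemma compact_bounded_diam A : compact A -> bounded_diam A.
Proof.
have [[x0 Ax0]|A0] := pselect (A !=set0); last first.
  by move=> _; exists 0 => x y Ax; exfalso; apply: A0; exists x.
move=> /compact_near_coveringP/(_ nat \oo (fun n x => mdist x0 x <= n%:R)) An.
have {An} : \forall n \near \oo, A `<=` [set x | mdist x0 x <= n%:R].
  apply: An => x Ax.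
  exists (ball x 1, [set n | mdist x0 x + 1 <= n%:R]) => /=.
    by split; [exact: nbhsx_ballx|exact: nbhs_infty_ger].
  case=> z n /= [xz xn]; apply: le_trans xn.
  rewrite (le_trans (metric_triangle _ x _))// lerD2l ltW//.
  by move: xz; rewrite ballEmdist.
case=> n _ /(_ n (leqnn n)) An; exists (n%:R + n%:R) => x y Ax Ay.
rewrite (le_trans (metric_triangle _ x0 _))// lerD// ?(metric_sym x); exact: An.
Qed.

Lemma set_dist_le A x a : A a -> set_dist x A <= mdist x a.
Proof.
by move=> Aa; apply: ge_inf; [exists 0 => _ [b _ <-]; exact: mdist_ge0|exists a].
Qed.

Lemma set_dist_ge A x (e : R) : A !=set0 ->
  (forall a, A a -> e <= mdist x a) -> e <= set_dist x A.
Proof.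
move=> A0 ea; apply: lb_le_inf; first exact: image_nonempty.
by move=> _ [a Aa <-]; exact: ea.
Qed.

Lemma set_dist_lt A x (e : R) : A !=set0 -> set_dist x A < e ->
  exists2 a, A a & mdist x a < e.
Proof.
move=> A0 xe; apply: contrapT => nx; move: xe; rewrite ltNge => /negP; apply.
apply: set_dist_ge => // a Aa; rewrite leNgt; apply/negP => ae.
by apply: nx; exists a.
Qed.

Lemma set_dist_self A x : A x -> set_dist x A = 0.
Proof.
move=> Ax; apply/eqP; rewrite eq_le -{1}(mdistxx x) set_dist_le//=.
by apply: set_dist_ge; [exists x|move=> a _; exact: mdist_ge0].
Qed.

Lemma set_dist_triangle A x y : A !=set0 ->
  set_dist x A <= mdist x y + set_dist y A.
Proof.
move=> A0; rewrite -lerBlDl; apply: set_dist_ge => // a Aa.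
by rewrite lerBlDl (le_trans (set_dist_le _ Aa))//; exact: metric_triangle.
Qed.

Lemma hausdorff_dist_sym A B : hausdorff_dist A B = hausdorff_dist B A.
Proof. exact: maxC. Qed.

Section hausdorff_dist_bounded.
Variable D : set X.
Hypothesis bD : bounded_diam D.

Let has_sup_dist A B : A `<=` D -> B `<=` D -> A !=set0 -> B !=set0 ->
  has_sup [set set_dist x B | x in A].
Proof.
case: bD => M DM AD BD A0 [b Bb]; split; first exact: image_nonempty.
exists M => _ [x Ax <-]; rewrite (le_trans (set_dist_le _ Bb))//.
by apply: DM; [exact: AD|exact: BD].
Qed.

Lemma hausdorff_distP A B (e : R) :
  A `<=` D -> B `<=` D -> A !=set0 -> B !=set0 ->
  hausdorff_dist A B <= e <-> (forall x, A x -> set_dist x B <= e) /\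
                              (forall x, B x -> set_dist x A <= e).
Proof.
move=> AD BD A0 B0; rewrite /hausdorff_dist ge_max; split=> [/andP[Ae Be]|[Ae Be]].
  split=> x Ex; [apply: le_trans Ae|apply: le_trans Be]; apply: ub_le_sup.
  - by have [] := has_sup_dist AD BD A0 B0.
  - by exists x.
  - by have [] := has_sup_dist BD AD B0 A0.
  - by exists x.
by apply/andP; split; apply: ge_sup;
  [exact: image_nonempty|move=> _ [x + <-]; exact: Ae|
   exact: image_nonempty|move=> _ [x + <-]; exact: Be].
Qed.

Lemma hausdorff_dist_ge A B x :
  A `<=` D -> B `<=` D -> A !=set0 -> B !=set0 -> A x ->
  set_dist x B <= hausdorff_dist A B.
Proof.
move=> AD BD A0 B0 Ax.
by have [+ _] := (@hausdorff_distP A B _ AD BD A0 B0).1 (lexx _); exact.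
Qed.

Lemma hausdorff_dist_ge0 A B :
  A `<=` D -> B `<=` D -> A !=set0 -> B !=set0 -> 0 <= hausdorff_dist A B.
Proof.
move=> AD BD A0 B0; have [x Ax] := A0.
apply: le_trans (hausdorff_dist_ge AD BD A0 B0 Ax).
by apply: set_dist_ge => // a _; exact: mdist_ge0.
Qed.

Lemma hausdorff_dist_triangle A B C : A `<=` D -> B `<=` D -> C `<=` D ->
  A !=set0 -> B !=set0 -> C !=set0 ->
  hausdorff_dist A C <= hausdorff_dist A B + hausdorff_dist B C.
Proof.
move=> AD BD CD A0 B0 C0.
have tri (A' B' C' : set X) x : A' `<=` D -> B' `<=` D -> C' `<=` D ->
    A' !=set0 -> B' !=set0 -> C' !=set0 -> A' x ->
    set_dist x C' <= hausdorff_dist A' B' + hausdorff_dist B' C'.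
  move=> AD' BD' CD' A0' B0' C0' Ax.
  apply: (@le_trans _ _ (set_dist x B' + hausdorff_dist B' C')); last first.
    by rewrite lerD2r hausdorff_dist_ge.
  rewrite -lerBlDr; apply: set_dist_ge => // b Bb; rewrite lerBlDr.
  rewrite (le_trans (set_dist_triangle x b C0'))// lerD2l.
  exact: hausdorff_dist_ge.
apply/(@hausdorff_distP A C _ AD CD A0 C0); split=> x Ex; first exact: tri.
rewrite addrC (hausdorff_dist_sym A) (hausdorff_dist_sym B); exact: tri.
Qed.


Definition levels_in u :=
  forall a, a \in `[0, 1] -> level u a `<=` D /\ level u a !=set0.

Lemma sup_distP u v (e : R) : levels_in u -> levels_in v ->
  sup_dist u v <= e <->
  forall a, a \in `[0, 1] -> hausdorff_dist (level u a) (level v a) <= e.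
Proof.
move=> uD vD; split=> [uve a a01|uve]; last first.
  apply: ge_sup; last by move=> _ [a a01 <-]; exact: uve.
  by exists (hausdorff_dist (level u 0) (level v 0)), 0; rewrite //= bound_itvE.
apply: le_trans uve; apply: ub_le_sup; last by exists a.
case: bD => M DM; exists M => _ [b b01 <-].
have [[uDb [x ux]] [vDb [y vy]]] := (uD _ b01, vD _ b01).
apply/(@hausdorff_distP _ _ M uDb vDb); [by exists x|by exists y|split=> z Ez].
  by rewrite (le_trans (set_dist_le _ vy))//; apply: DM; [exact: uDb|exact: vDb].
by rewrite (le_trans (set_dist_le _ ux))//; apply: DM; [exact: vDb|exact: uDb].
Qed.

Lemma le_sup_dist u v a : levels_in u -> levels_in v -> a \in `[0, 1] ->
  hausdorff_dist (level u a) (level v a) <= sup_dist u v.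
Proof. move=> uD vD; exact: (sup_distP _ uD vD).1. Qed.

Lemma sup_dist_ge0 u v : levels_in u -> levels_in v -> 0 <= sup_dist u v.
Proof.
move=> uD vD; have z01 : (0 : R) \in `[0, 1] by rewrite bound_itvE.
apply: le_trans (le_sup_dist uD vD z01).
by have [[? ?] [? ?]] := (uD _ z01, vD _ z01); exact: hausdorff_dist_ge0.
Qed.

Lemma sup_dist_self u : levels_in u -> sup_dist u u = 0.
Proof.
move=> uD; apply/eqP; rewrite eq_le sup_dist_ge0// andbT.
apply/sup_distP => // a /uD[aD a0]; apply/hausdorff_distP => //.
by split=> x ax; rewrite set_dist_self.
Qed.

Lemma sup_dist_sym u v : sup_dist u v = sup_dist v u.
Proof.
by rewrite /sup_dist; under eq_imagel do rewrite hausdorff_dist_sym.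
Qed.

Lemma sup_dist_triangle u v w : levels_in u -> levels_in v -> levels_in w ->
  sup_dist u w <= sup_dist u v + sup_dist v w.
Proof.
move=> uD vD wD; apply/sup_distP => // a a01.
have [[? ?] [? ?] [? ?]] := And3 (uD _ a01) (vD _ a01) (wD _ a01).
apply: (@le_trans _ _ (hausdorff_dist (level u a) (level v a) +
                       hausdorff_dist (level v a) (level w a))).
  exact: hausdorff_dist_triangle.
by rewrite lerD// le_sup_dist.
Qed.

End hausdorff_dist_bounded.

Lemma fuzzy_levels_in D (u : fuzzy) : level u 0 `<=` D -> levels_in D u.
Proof.
move=> uD a; rewrite in_itv/= => a01; split; last exact: fuzzy_level_neq0.
by apply: subset_trans uD; apply: level_sub0; case/andP: a01.
Qed.

Lemma homeo_sym (xi zeta : R -> R) :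
  {in `[0, 1], cancel zeta xi} ->
  set_fun `[0, 1]%classic `[0, 1]%classic zeta ->
  {in `[0, 1] &, {homo xi : a b / a < b}} ->
  {in `[0, 1] &, {homo zeta : a b / a < b}}.
Proof.
move=> zK z01 xi_lt a b a01 b01 ab; rewrite ltNge le_eqVlt.
apply/negP => /predU1P[/(congr1 xi)|].
  by rewrite !zK// => ba; move: ab; rewrite ba ltxx.
move=> /(xi_lt _ _ (z01 _ b01) (z01 _ a01)); rewrite !zK// => /(lt_trans ab).
by rewrite ltxx.
Qed.

Lemma level_homeo (xi zeta : R -> R) v a :
  (forall x, v x \in `[0, 1]) ->
  set_fun `[0, 1]%classic `[0, 1]%classic xi ->
  set_fun `[0, 1]%classic `[0, 1]%classic zeta ->
  {in `[0, 1], cancel xi zeta} -> {in `[0, 1], cancel zeta xi} ->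
  {in `[0, 1] &, {homo xi : a b / a < b}} -> a \in `[0, 1] ->
  level (xi \o v) a = level v (zeta a).
Proof.
move=> v01 xi01 ze01 xiK zeK xi_lt a01.
have xi_le : {in `[0, 1] &, {mono xi : a b / a <= b}} by exact: le_mono_in.
have z01 : (0 : R) \in `[0, 1] by rewrite bound_itvE.
have xi0 : xi 0 = 0.
  apply/eqP; rewrite eq_le; have := xi01 _ z01; rewrite /= in_itv/= => /andP[-> _].
  rewrite andbT -[leRHS](zeK 0)// xi_le//; last exact: ze01.
  by have := ze01 _ z01; rewrite /= in_itv/= => /andP[].
have ze0 : (zeta a == 0) = (a == 0).
  apply/eqP/eqP => [za|->]; first by rewrite -(zeK a)// za xi0.
  by rewrite -[in LHS]xi0 xiK.
rewrite /level ze0; case: ifPn => _.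
  congr closure; apply/funext => x /=; congr is_true.
  by rewrite -{1}xi0 (leW_mono_in xi_le).
apply/funext => x /=; congr is_true.
by rewrite -{1}(zeK a)// xi_le//; exact: ze01.
Qed.


Lemma homeo_id : increasing_homeo id.
Proof.
exists id; split; [by split|by split| |by []].
by split; apply: continuous_subspaceT => a; exact: cvg_id.
Qed.

Lemma homeo_inv xi : increasing_homeo xi -> exists zeta,
  [/\ increasing_homeo zeta, {in `[0, 1], cancel xi zeta} &
      {in `[0, 1], cancel zeta xi}].
Proof.
case=> zeta [[xi01 ze01] [xiK zeK] [cxi cze] xi_lt]; exists zeta; split=> //.
by exists xi; split=> //; exact: (homeo_sym zeK).
Qed.

Let within_comp (A : set R) (g h : R -> R) : set_fun A A h ->
  {within A, continuous g} -> {within A, continuous h} ->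
  {within A, continuous (g \o h)}.
Proof.
move=> hA /subspace_continuousP cg /subspace_continuousP ch.
apply/subspace_continuousP => x Ax P /= /(cg _ (hA _ Ax)) /= gP.
have Hx : nbhs x [set z | A z -> A (h z) -> P (g (h z))] := ch x Ax _ gP.
change (nbhs x [set z | A z -> P (g (h z))]).
by apply: filterS Hx => z /= hz Az; apply: hz => //; exact: hA.
Qed.

Lemma homeo_comp xi1 xi2 :
  increasing_homeo xi1 -> increasing_homeo xi2 -> increasing_homeo (xi1 \o xi2).
Proof.
case=> zeta1 [[xi101 ze101] [xi1K ze1K] [cxi1 cze1] xi1_lt].
case=> zeta2 [[xi201 ze201] [xi2K ze2K] [cxi2 cze2] xi2_lt].
exists (zeta2 \o zeta1); split; [split|split|split|].
- by move=> a a01 /=; apply: xi101; exact: xi201.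
- by move=> a a01 /=; apply: ze201; exact: ze101.
- by move=> a a01 /=; rewrite xi1K ?xi2K//; exact: xi201.
- by move=> a a01 /=; rewrite ze2K ?ze1K//; exact: ze101.
- exact: within_comp.
- exact: within_comp.
- move=> a b a01 b01 ab /=.
  exact: (xi1_lt _ _ (xi201 _ a01) (xi201 _ b01) (xi2_lt _ _ a01 b01 ab)).
Qed.

Lemma homeo_levels_in D xi u : (forall x, u x \in `[0, 1]) ->
  increasing_homeo xi -> levels_in D u -> levels_in D (xi \o u).
Proof.
move=> u01 [zeta [[xi01 ze01] [xiK zeK] _ xi_lt]] uD a a01.
by rewrite (level_homeo u01 xi01 ze01 xiK zeK xi_lt a01); exact/uD/ze01.
Qed.

Lemma sup_dist_homeo_le D xi u v : bounded_diam D ->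
  levels_in D u -> levels_in D v ->
  (forall x, u x \in `[0, 1]) -> (forall x, v x \in `[0, 1]) ->
  increasing_homeo xi -> sup_dist (xi \o u) (xi \o v) <= sup_dist u v.
Proof.
move=> bD uD vD u01 v01 hxi.
apply/(sup_distP bD _ (homeo_levels_in u01 hxi uD)
  (homeo_levels_in v01 hxi vD)) => a a01.
case: hxi => [zeta [[xi01 ze01] [xiK zeK] _ xi_lt]].
rewrite (level_homeo u01 xi01 ze01 xiK zeK xi_lt a01).
rewrite (level_homeo v01 xi01 ze01 xiK zeK xi_lt a01).
exact: (le_sup_dist bD uD vD (ze01 _ a01)).
Qed.

Lemma sup_homeoP xi (e : R) : increasing_homeo xi ->
  sup [set `|xi a - a| | a in `[0, 1]%classic] <= e <->
  forall a, a \in `[0, 1] -> `|xi a - a| <= e.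
Proof.
case=> zeta [[xi01 _] _ _ _]; split=> [xie a a01|xie]; last first.
  apply: ge_sup; last by move=> _ [a a01 <-]; exact: xie.
  by exists `|xi 0 - 0|, 0; rewrite //= bound_itvE.
apply: le_trans xie; apply: ub_le_sup; last by exists a.
exists 1 => _ [b b01 <-]; have := xi01 _ b01; move: b01; rewrite /= !in_itv/=.
by move=> /andP[? ?] /andP[? ?]; rewrite ler_norml; apply/andP; split; lra.
Qed.

Let admissible u v : set R := [set e | exists xi, [/\ increasing_homeo xi,
    sup [set `|xi a - a| | a in `[0, 1]%classic] <= e &
    sup_dist u (xi \o v) <= e]].

Let fuzzy01 (u : fuzzy) x : u x \in `[0, 1].
Proof. by rewrite in_itv/= fuzzy_itv. Qed.

Let admissible_ge0 (u v : fuzzy) e : admissible u v e -> 0 <= e.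
Proof.
case=> xi [hxi /(sup_homeoP _ hxi) xie _].
by apply: le_trans (xie 0 _); rewrite // bound_itvE.
Qed.

Let support2 (u v : fuzzy) : exists D, [/\ bounded_diam D, levels_in D u &
  levels_in D v].
Proof.
exists (level u 0 `|` level v 0); split.
- by apply: compact_bounded_diam; apply: compactU; exact: fuzzy_compact.
- exact/fuzzy_levels_in/subsetUl.
- exact/fuzzy_levels_in/subsetUr.
Qed.

Let support3 (u v w : fuzzy) : exists D, [/\ bounded_diam D, levels_in D u,
  levels_in D v & levels_in D w].
Proof.
exists (level u 0 `|` level v 0 `|` level w 0); split.
- apply: compact_bounded_diam; apply: compactU; last exact: fuzzy_compact.
  by apply: compactU; exact: fuzzy_compact.
- by apply: fuzzy_levels_in => x; left; left.
- by apply: fuzzy_levels_in => x; left; right.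
- by apply: fuzzy_levels_in => x; right.
Qed.

Let admissible_id (u v : fuzzy) : admissible u v (sup_dist u v).
Proof.
have [D [bD uD vD]] := support2 u v.
exists id; split=> //; first exact: homeo_id.
apply/(sup_homeoP _ homeo_id) => a _; rewrite subrr normr0.
exact: (sup_dist_ge0 bD uD vD).
Qed.

Let admissible_sym (u v : fuzzy) e : admissible u v e -> admissible v u e.
Proof.
have [D [bD uD vD]] := support2 u v.
case=> xi [hxi /(sup_homeoP _ hxi) xie uve].
have [zeta [hze xiK zeK]] := homeo_inv hxi; exists zeta; split=> //.
  apply/(sup_homeoP _ hze) => a a01; rewrite -[X in _ - X]zeK// distrC.
  by apply: xie; case: hze => ? [[+ _] _ _ _]; exact.
apply: le_trans uve; rewrite sup_dist_sym.
rewrite [X in sup_dist _ X <= _](_ : (v : X -> R) = zeta \o (xi \o v)); last first.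
  by apply/funext => x /=; rewrite xiK.
apply: (sup_dist_homeo_le bD) => //; first exact: homeo_levels_in.
by move=> x /=; case: hxi => ? [[xi01 _] _ _ _]; exact/xi01/fuzzy01.
Qed.

Let admissible_triangle (u v w : fuzzy) e1 e2 :
  admissible u v e1 -> admissible v w e2 -> admissible u w (e1 + e2).
Proof.
have [D [bD uD vD wD]] := support3 u v w.
case=> xi1 [h1 /(sup_homeoP _ h1) xie1 uve].
case=> xi2 [h2 /(sup_homeoP _ h2) xie2 vwe].
have h12 := homeo_comp h1 h2; exists (xi1 \o xi2); split=> //.
  apply/(sup_homeoP _ h12) => a a01 /=.
  rewrite (le_trans (ler_distD (xi2 a) _ _))// lerD ?xie2// xie1//.
  by case: h2 => ? [[xi01 _] _ _ _]; exact: xi01.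
have xi2w01 x : (xi2 \o w) x \in `[0, 1].
  by case: h2 => ? [[xi01 _] _ _ _]; exact/xi01/fuzzy01.
apply: (le_trans (sup_dist_triangle bD uD (homeo_levels_in (fuzzy01 v) h1 vD) _)).
  exact: homeo_levels_in.
apply: lerD => //; apply: le_trans vwe.
apply: (sup_dist_homeo_le bD) => //; exact: homeo_levels_in.
Qed.

Let admissible_le (u v : fuzzy) :
  (forall e, 0 < e -> exists2 e', admissible u v e' & e' < e) ->
  forall x, u x <= v x.
Proof.
have [D [bD uD vD]] := support2 u v.
move=> uv x; rewrite leNgt; apply/negP => vux.
pose c := (v x + u x) / 2.
have [vc cu] : v x < c /\ c < u x by rewrite !midf_lt.
have ux0 : 0 < u x by apply: le_lt_trans vux; exact: fuzzy_ge0.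
have /nbhs_ballP[d /= d0 dc] := fuzzy_usc vc.
have [|e [xi [hxi /(sup_homeoP _ hxi) xie uve]]] := uv (Num.min d (u x - c)).
  by rewrite lt_min d0 subr_gt0.
rewrite lt_min => /andP[ed ec].
have xD := homeo_levels_in (fuzzy01 v) hxi vD.
have [[uDx u0] [vDx v0]] := (uD _ (fuzzy01 u x), xD _ (fuzzy01 u x)).
have ux : level u (u x) x by rewrite /level gt_eqF/=.
have := hausdorff_dist_ge bD uDx vDx u0 v0 ux.
move=> /le_trans/(_ (le_sup_dist bD uD xD (fuzzy01 u x))).
move=> /le_trans/(_ uve) /le_lt_trans/(_ ed) /(set_dist_lt v0)[y].
rewrite /level gt_eqF//= => uxy xy.
have : v y < c by apply: dc; rewrite ballEmdist.
have := xie _ (fuzzy01 v y); rewrite ler_norml => /andP[_].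
by move: ec uxy => /=; lra.
Qed.

Let has_inf_admissible (u v : fuzzy) : has_inf (admissible u v).
Proof.
split; first by exists (sup_dist u v); exact: admissible_id.
by exists 0 => e; exact: admissible_ge0.
Qed.

Lemma skorokhod_dist_le (u v : fuzzy) : skorokhod_dist u v <= sup_dist u v.
Proof.
by apply: ge_inf; [case: (has_inf_admissible u v)|exact: admissible_id].
Qed.

Lemma skorokhod_dist_self (u : fuzzy) : skorokhod_dist u u = 0.
Proof.
have [D [bD uD _]] := support2 u u.
apply/eqP; rewrite eq_le (le_trans (skorokhod_dist_le u u)) ?(sup_dist_self bD)//=.
by apply: lb_le_inf; [case: (has_inf_admissible u u)|exact: admissible_ge0].
Qed.

Lemma skorokhod_dist_sym (u v : fuzzy) : skorokhod_dist u v = skorokhod_dist v u.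
Proof.
by congr inf; apply/seteqP; split=> e; exact: admissible_sym.
Qed.

Lemma skorokhod_dist_eq0 (u v : fuzzy) : skorokhod_dist u v = 0 -> u = v.
Proof.
suff le (u' v' : fuzzy) : skorokhod_dist u' v' = 0 -> forall x, u' x <= v' x.
  move=> uv; apply: fuzzy_eq => x; apply: le_anti; apply/andP; split.
    exact: le uv x.
  by apply: le; rewrite skorokhod_dist_sym.
move=> uv; apply: admissible_le => e e0.
have [e' ae' +] := inf_adherent e0 (has_inf_admissible u' v').
by rewrite -/(skorokhod_dist u' v') uv add0r; exists e'.
Qed.

Lemma skorokhod_dist_triangle (v u w : fuzzy) :
  skorokhod_dist u w <= skorokhod_dist u v + skorokhod_dist v w.
Proof.
apply/ler_addgt0Pr => e e0; have e20 : 0 < e / 2 by rewrite divr_gt0.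
have [e1 a1 he1] := inf_adherent e20 (has_inf_admissible u v).
have [e2 a2 he2] := inf_adherent e20 (has_inf_admissible v w).
apply: (@le_trans _ _ (e1 + e2)).
  apply: ge_inf; first by case: (has_inf_admissible u w).
  exact: admissible_triangle a1 a2.
by rewrite (splitr e) addrACA; apply: lerD; [exact: (ltW he1)|exact: (ltW he2)].
Qed.

Lemma sup_dist_eq0 (u v : fuzzy) : sup_dist u v = 0 -> u = v.
Proof.
move=> uv; apply: skorokhod_dist_eq0; apply/eqP.
rewrite eq_le -{1}uv skorokhod_dist_le/=.
by apply: lb_le_inf; [case: (has_inf_admissible u v)|exact: admissible_ge0].
Qed.

Lemma sup_dist_fuzzy_self (u : fuzzy) : sup_dist u u = 0.
Proof. by have [D [bD uD _]] := support2 u u; exact: sup_dist_self uD. Qed.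

Lemma sup_dist_fuzzy_triangle (v u w : fuzzy) :
  sup_dist u w <= sup_dist u v + sup_dist v w.
Proof.
by have [D [bD uD vD wD]] := support3 u v w; exact: (sup_dist_triangle bD).
Qed.

Definition fuzzy_infty := fuzzy.

HB.instance Definition _ := Choice.on fuzzy_infty.
HB.instance Definition _ := @isMetric.Build R fuzzy_infty
  (fun u v : fuzzy => sup_dist u v)
  sup_dist_fuzzy_self sup_dist_eq0 (fun u v : fuzzy => sup_dist_sym u v)
  sup_dist_fuzzy_triangle.

Definition fuzzy_skorokhod := fuzzy.

HB.instance Definition _ := Choice.on fuzzy_skorokhod.
HB.instance Definition _ := @isMetric.Build R fuzzy_skorokhod
  (fun u v : fuzzy => skorokhod_dist u v)
  skorokhod_dist_self skorokhod_dist_eq0 skorokhod_dist_sym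
  skorokhod_dist_triangle.

End fuzzy_sets.

(* Main.v *)
(* Both recurrence properties reduce to return properties of open sets: for
   every l in a given family, each non-empty open set U contains a point y
   with g^(jn) y in U for all j <= l, for some n >= 1 (l = 1 for
   point-recurrence, all l for AP-recurrence).

   From K(X) to X^N: let K, f^n K, ..., f^(ln) K all meet every U_i and lie in
   their union.  Either each point of K in some U_i stays in U_i, or f^(jn)
   sends a point of U_i into another U_k; then U_i and U_k may be replaced by
   the single set [U_i `&` f^-(jn) U_k], because f^(jn) commutes with f^m, and one
   concludes by induction on the number of sets.  A Baire category argument
   with nested boxes in X^N then produces a dense set of recurrent points.
   For the Skorokhod metric, a reparametrization of the levels fixes the level
   1, so passing to u_1 gives the same property of compact sets.

   From X^N: a recurrent (y_1, ..., y_N) yields the recurrent compact set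
   {y_1, ..., y_N} and, for weights w_i in ]0, 1] of maximum 1, the recurrent
   fuzzy set max_i w_i 1_{y_i}.  These are dense in K(X) and F_infty(X), and
   the identity F_infty(X) -> F_0(X) is continuous. *)
Require Import Defs.
From HB Require Import structures.
From mathcomp Require Import all_boot all_order all_algebra.
From mathcomp Require Import all_classical all_reals all_analysis.
From mathcomp Require Import lra.

Set Implicit Arguments.
Unset Strict Implicit.
Unset Printing Implicit Defensive.

Import Order.TTheory GRing.Theory Num.Theory.
Import numFieldNormedType.Exports.

Local Open Scope classical_set_scope.
Local Open Scope ring_scope.

(** * Return properties of open sets *)

(** For [l = 1] no non-empty open set is wandering; for all [l] together this is topological
    multiple recurrence. The index [j = 0] places [y] itself in [U]. *)
Definition progression_return (Y : topologicalType) (g : Y -> Y) (l : nat) :=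
  forall U, open U -> U !=set0 -> exists n y, (0 < n)%N /\
    forall j, (j <= l)%N -> U (iter (j * n) g y).

Lemma point_recurrent_return (Y : topologicalType) (g : Y -> Y) :
  point_recurrent Y g -> progression_return g 1.
Proof.
move=> rg U oU U0; have [y [Uy ry]] := rg U U0 oU.
suff [n n0 Un] : exists2 n, (0 < n)%N & U (iter n g y).
  by exists n, y; split=> // -[|[|//]] _; rewrite ?mul1n.
apply: contrapT => nU; apply: (ry U (open_nbhs_nbhs (conj oU Uy))).
(* Without a positive return time the return set lies in {0}. *)
apply: (@sub_finite_set _ _ [set 0%N]); last exact: finite_set1.
by case=> [//|n Un]; exfalso; apply: nU; exists n.+1.
Qed.

Lemma AP_recurrent_return (Y : topologicalType) (g : Y -> Y) (l : nat) :
  AP_recurrent Y g -> progression_return g l.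
Proof.
move=> rg U oU U0; have [y [Uy ry]] := rg U U0 oU.
(* [l.+1] because AP-recurrence only speaks of positive lengths, while [l] may be 0. The point is
   then moved to the start of the progression. *)
have [n [m [n0 Un]]] := ry U (open_nbhs_nbhs (conj oU Uy)) l.+1 isT.
exists n, (iter m g y); split=> // j jl.
by rewrite -iterD addnC; apply/Un/leqW.
Qed.

Lemma continuous_iter (Y : topologicalType) (g : Y -> Y) n :
  continuous g -> continuous (iter n g).
Proof.
move=> cg; elim: n => [|n IH] y; first exact: cvg_id.
exact: (@continuous_comp _ _ _ (iter n g) g y (IH y) (cg _)).
Qed.

(** The returns of [K] may mix the sets of [Us], whereas here each [U] gets a point of its own with
    a common [n]. A point passing from [U] to [V] allows both to be merged, so the induction is on
    the length of the list. *)
Lemma joint_return (X : topologicalType) (f : X -> X) (l : nat) :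
  continuous f ->
  (forall Us, @vietoris_index X Us -> exists n (K : set X), (0 < n)%N /\
    forall j, (j <= l)%N -> iter (j * n) f @` K `<=` \bigcup_(U in Us) U /\
      forall U, Us U -> (iter (j * n) f @` K) `&` U !=set0) ->
  forall Us : seq (set X), (forall U, U \in Us -> open U /\ U !=set0) ->
  exists2 n, (0 < n)%N & forall U, U \in Us ->
    exists x, forall j, (j <= l)%N -> U (iter (j * n) f x).
Proof.
move=> cf HK Us; have [k] := ubnP (size Us); elim: k Us => // k IH Us sUs oUs.
have [->|Us0] := eqVneq Us [::]; first by exists 1%N.
have [|n [K [n0 Kn]]] := HK [set` Us].
  split=> [|| U]; [exact: finite_seq| |exact: oUs].
  by case: Us Us0 {IH sUs oUs} => // U Us _; exists U; rewrite /= mem_head.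
have [[U [j [x [UUs jl Kx Ux nUx]]]]|nswitch] := pselect (exists U j x,
    [/\ U \in Us, (j <= l)%N, K x, U x & ~ U (iter (j * n) f x)]); last first.
  (* Points of [K] in [U] stay in [U] here, and [j = 0] provides one. *)
  exists n => // U UUs; have [_ /(_ U UUs)[x [[y Ky <-]]]] := Kn 0%N isT.
  rewrite mul0n /= => Uy; exists y => j jl.
  by apply: contrapT => nUj; apply: nswitch; exists U, j, y.
have [+ _] := Kn j jl; move=> /(_ (iter (j * n) f x))[|V /= VUs Vx].
  by exists x.
have UV : U != V by apply/eqP => eUV; move: nUx; rewrite eUV.
pose U' := U `&` iter (j * n) f @^-1` V.
have oU' : open U'.
  apply: openI; first by have [] := oUs U UUs.
  apply: open_comp; first by move=> z _; exact: continuous_iter.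
  by have [] := oUs V VUs.
pose Vs := [seq W <- Us | W != V].
have [||m m0 Hm] := IH (map (fun W => if W == U then U' else W) Vs).
- rewrite size_map size_filter (leq_trans _ (_ : size Us <= k)%N)//.
  rewrite -(count_predC (pred1 V) Us) -[X in (X < _)%N]add0n ltn_add2r.
  by rewrite -has_count has_pred1.
- move=> W' /mapP[W]; rewrite mem_filter => /andP[_ WUs] ->.
  by case: ifP => _; [split=> //; exists x; split|exact: oUs].
have HU' : exists y, forall i, (i <= l)%N -> U' (iter (i * m) f y).
  apply: Hm; apply/mapP; exists U; last by rewrite eqxx.
  by rewrite mem_filter UV.
exists m => // W WUs.
have [->|WV] := eqVneq W V.
  have [y Hy] := HU'; exists (iter (j * n) f y) => i il.
  by rewrite -iterD addnC iterD; have [] := Hy i il.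
have [->|WU] := eqVneq W U.
  by have [y Hy] := HU'; exists y => i il; have [] := Hy i il.
apply: Hm; apply/mapP; exists W; last by rewrite (negbTE WU).
by rewrite mem_filter WV.
Qed.

(** * Neighbourhoods in the product spaces *)

(** The filter [F] generated by the boxes around [y] converges to [y] in each coordinate, hence in
    the coarsest topology making the projections continuous. Conversely, a box is a finite
    intersection of preimages under projections. *)
Lemma product_nbhsP (X : topologicalType) N (y : {ptws 'I_N -> X}) U :
  nbhs y U <-> exists2 W : 'I_N -> set X, (forall i, nbhs (y i) (W i)) &
    forall z, (forall i, W i (z i)) -> U z.
Proof.
pose F : set_system {ptws 'I_N -> X} := [set A |
  exists2 W : 'I_N -> set X, (forall i, nbhs (y i) (W i)) &
    forall z, (forall i, W i (z i)) -> A z].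
have FF : Filter F.
  split.
  - by exists (fun=> setT) => // i; exact: filterT.
  - move=> A B [V Vy VA] [W Wy WB]; exists (fun i => V i `&` W i).
      by move=> i; exact: filterI.
    by move=> z VWz; split; [apply: VA|apply: WB] => i; have [] := VWz i.
  - by move=> A B AB [V Vy VA]; exists V => // z /VA /AB.
split=> [|[W Wy WU]].
  suff : F --> y by exact.
  apply/cvg_sup => i A [B [[C oC <-] /= Cy] BA].
  exists (fun j => if j == i then C else setT).
    by move=> j; case: eqP => [->|_]; [exact: open_nbhs_nbhs|exact: filterT].
  by move=> z /(_ i); rewrite eqxx => /BA.
have Fy : Filter (nbhs y) by exact: nbhs_filter.
apply: (filterS WU).
have Hi i : nbhs y [set z : {ptws 'I_N -> X} | W i (z i)].
  exact: (@proj_continuous _ (fun=> X) i y (W i) (Wy i)).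

exact: (filter_forall Fy Hi).
Qed.

Lemma uniform_radius (R : realType) (X : metricType R) N (y : 'I_N -> X)
    (W : 'I_N -> set X) : (forall i, nbhs (y i) (W i)) ->
  exists2 e : R, 0 < e & forall i, ball (y i) e `<=` W i.
Proof.
move=> Wy.
have : \forall e \near (0 : R)^'+, forall i, ball (y i) e `<=` W i.
  apply: filter_forall => i; have /nbhs_ballP[d /= d0 dW] := Wy i.
  near=> e; apply: subset_trans dW; apply: le_ball.
  by near: e; exact: nbhs_right_le.
move=> He; near (0 : R)^'+ => e; exists e; first by near: e; exact: nbhs_right_gt.
by near: e.
Unshelve. all: by end_near. Qed.

Lemma product_box_nbhs (R : realType) (X : metricType R) N
    (y : {ptws 'I_N -> X}) U :
  nbhs y U -> exists2 e : R, 0 < e &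
    forall z, (forall i, mdist (y i) (z i) < e) -> U z.
Proof.
move=> /product_nbhsP[W Wy WU]; have [e e0 He] := uniform_radius Wy.
exists e => // z yz; apply: WU => i; apply: He.
by rewrite ballEmdist; exact: yz.
Qed.

Lemma iter_direct_product (X : topologicalType) (f : X -> X) N n
    (y : {ptws 'I_N -> X}) i : iter n (direct_product f (N := N)) y i = iter n f (y i).
Proof. by elim: n i => //= n IH i; rewrite /direct_product IH. Qed.

Lemma cvg_mdist_le (R : realType) (X : metricType R) (u : nat -> X) l k (r : R) :
  u @ \oo --> l -> (forall m, (k <= m)%N -> mdist (u k) (u m) <= r) ->
  mdist (u k) l <= r.
Proof.
move=> ul ur; apply/ler_addgt0Pr => e e0.
have : \forall m \near \oo, ball l e (u m) by apply: ul; exact: nbhsx_ballx.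
move=> Hu; near \oo => m.
rewrite (le_trans (metric_triangle _ (u m) _))// lerD//.
  by apply: ur; near: m; exact: nbhs_infty_ge.
rewrite metric_sym ltW//; have : ball l e (u m) by near: m.
by rewrite ballEmdist.
Unshelve. all: by end_near. Qed.

(** * Baire argument in the product spaces *)

Section product_return_points.
Variables (R : realType) (X : metricType R) (f : X -> X) (N : nat).
Variable l : nat -> nat.
Hypothesis complete_X : complete_space X.
Hypothesis cf : continuous f.
Hypothesis joint : forall k (U : 'I_N -> set X),
  (forall i, open (U i) /\ U i !=set0) ->
  exists2 n, (0 < n)%N & forall i, exists x, forall j, (j <= l k)%N ->
    U i (iter (j * n) f x).

Let returns k (y : 'I_N -> X) := exists2 n, (0 < n)%N &
  forall i j, (j <= l k)%N -> mdist (y i) (iter (j * n) f (y i)) < k.+1%:R^-1.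

(** Closed boxes, so that the limit of the centres stays in each of them. *)
Let in_box (b : ('I_N -> X) * R) (y : 'I_N -> X) :=
  forall i, mdist (b.1 i) (y i) <= b.2.

(** By [joint], points [z i] have all their returns in small balls around the old centres; by
    continuity so do all points of a small box around [z], and two points of one small ball are
    close to each other. *)
Let shrink_box k b : 0 < b.2 -> exists c, [/\ 0 < c.2, c.2 <= k.+1%:R^-1 &
  forall y, in_box c y -> in_box b y /\ returns k y].
Proof.
(* [d] is half the precision because [y i] and its returns are compared through [x i]; the minimum
   [e] keeps the new box inside the old one. *)
case: b => x r /= r0; pose d := k.+1%:R^-1 / 2 : R.
have d0 : 0 < d by rewrite divr_gt0// invr_gt0 ltr0n.
pose e := Num.min r d; have e0 : 0 < e by rewrite lt_min r0.
have [|n n0 Hn] := @joint k (fun i => interior (ball (x i) e)).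
  move=> i; split; first exact: open_interior.
  by exists (x i); exact: nbhsx_ballx.
have [z Hz] := choice Hn.
have He : \forall c \near (0 : R)^'+, forall (i : 'I_N) (j : 'I_(l k).+1) y,
    mdist (z i) y <= c -> ball (x i) e (iter (j * n) f y).
  apply: filter_forall => i; apply: filter_forall => j.
  have : nbhs (z i) (iter (j * n) f @^-1` ball (x i) e).
    by apply: continuous_iter => //; apply: Hz; rewrite -ltnS.
  move=> /nbhs_ballP[c /= c0 Hc]; near=> a => y zy; apply: Hc.
  rewrite ballEmdist /=; apply: le_lt_trans zy _; near: a.
  exact: nbhs_right_lt.
have k0 : 0 < k.+1%:R^-1 :> R by rewrite invr_gt0 ltr0n.
near (0 : R)^'+ => c; exists (z, c) => /=; split.
- by near: c; exact: nbhs_right_gt.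
- by near: c; exact: nbhs_right_le.
move=> y zy.
have Hc : forall (i : 'I_N) (j : 'I_(l k).+1) y,
    mdist (z i) y <= c -> ball (x i) e (iter (j * n) f y) by near: c.
have xy i : ball (x i) e (y i) by have := Hc i ord0 (y i) (zy i).
split=> [i|].
  have := xy i; rewrite ballEmdist /= => /ltW /le_trans; apply.
  by rewrite /e ge_min lexx.
exists n => // i j jl; have := Hc i (Ordinal (jl : (j < (l k).+1)%N)) (y i) (zy i).
have := xy i; rewrite !ballEmdist /= => xyi xfyi.
rewrite (le_lt_trans (metric_triangle _ (x i) _))// metric_sym.
have ed : e <= d by rewrite /e ge_min lexx orbT.
rewrite [ltRHS](splitr k.+1%:R^-1); apply: ltrD.
  exact: lt_le_trans ed.
exact: lt_le_trans ed.
Unshelve. all: by end_near. Qed.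

Lemma product_return_point (x : 'I_N -> X) r : 0 < r ->
  exists y, (forall i, mdist (x i) (y i) <= r) /\ forall k, returns k y.
Proof.
move=> r0.
(* The positivity of the radius is part of the chosen property, so that [s] is total; boxes without
   positive radius are mapped to themselves. *)
have /choice[s Hs] : forall kb : nat * (('I_N -> X) * R), exists c,
    0 < kb.2.2 -> [/\ 0 < c.2, c.2 <= kb.1.+1%:R^-1 &
      forall y, in_box c y -> in_box kb.2 y /\ returns kb.1 y].
  move=> [k b] /=; have [/(shrink_box k)[c Hc]|b0] := ltP 0 b.2.
    by exists c.
  by exists b.
pose B := fix B k := if k is k'.+1 then s (k', B k') else (x, r).
have B0 k : 0 < (B k).2 by elim: k => //= k /(Hs (k, B k))[].
have BS k := Hs (k, B k) (B0 k).
have Bin k m y : in_box (B (m + k)%N) y -> in_box (B k) y.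
  by elim: m => // m IH /= By; apply: IH; have [_ _ /(_ y By)[]] := BS (m + k)%N.
have Bc k m : (k <= m)%N -> in_box (B k) (B m).1.
  move=> km; apply: (Bin k (m - k)%N); rewrite subnK// => i.
  by rewrite mdistxx ltW.
have /choice[y Hy] (i : 'I_N) : exists z : X, (fun k => (B k).1 i) @ \oo --> z.
  (* All later centres lie in box [k.+1], whose radius is at most [k.+1%:R^-1]. *)
  apply: complete_X; apply/cauchy_exP => e e0.
  have [k ke] : exists k, k.+1%:R^-1 < e.
    near \oo => k; exists k; near: k; exact: near_infty_natSinv_lt (PosNum e0).
  exists ((B k.+1).1 i), k.+1 => // m /= km.
  rewrite ballEmdist /=; apply: le_lt_trans (Bc _ _ km i) _.
  by apply: le_lt_trans ke; have [] := BS k.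
have By k : in_box (B k) y.
  by move=> i; apply: cvg_mdist_le (Hy i) _ => m km; exact: Bc.
exists y; split; first exact: (By 0%N).
by move=> k; have [_ _ /(_ y (By k.+1))[]] := BS k.
Unshelve. all: by end_near. Qed.

End product_return_points.

(** Returns are claimed at every late stage [k] and not just at one, so that [l k] exceeds any
    prescribed length when [l] is unbounded. *)
Lemma product_returns_dense (R : realType) (X : metricType R) (f : X -> X)
    (l : nat -> nat) N : complete_space X -> continuous f ->
  (forall k (Us : seq (set X)), (forall U, U \in Us -> open U /\ U !=set0) ->
    exists2 n, (0 < n)%N & forall U, U \in Us ->
      exists x, forall j, (j <= l k)%N -> U (iter (j * n) f x)) ->
  dense [set y : {ptws 'I_N -> X} | forall U, nbhs y U ->
    exists k0, forall k, (k0 <= k)%N -> exists2 n, (0 < n)%N &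
      forall j, (j <= l k)%N -> U (iter (j * n) (direct_product f (N := N)) y)].
Proof.
move=> complete_X cf joint O [x Ox] oO.
have [r r0 Hr] := product_box_nbhs (open_nbhs_nbhs (conj oO Ox)).
have r20 : 0 < r / 2 by rewrite divr_gt0.
have jointN k (U : 'I_N -> set X) : (forall i, open (U i) /\ U i !=set0) ->
    exists2 n, (0 < n)%N & forall i, exists x, forall j, (j <= l k)%N ->
      U i (iter (j * n) f x).
  move=> oU; have [|n n0 Hn] := joint k (codom U).
    by move=> _ /codomP[i ->].
  by exists n => // i; apply: Hn; exact: codom_f.
have [y [xy Hy]] := product_return_point complete_X cf jointN x r20.
exists y; split.
  by apply: Hr => i; rewrite (le_lt_trans (xy i))// gtr_pMr// invf_lt1// ltr1n.
move=> U /product_box_nbhs[e e0 He].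
have [k0 k0e] : exists k, k.+1%:R^-1 < e.
  near \oo => k; exists k; near: k; exact: near_infty_natSinv_lt (PosNum e0).
exists k0 => k k0k; have [n n0 Hn] := Hy k; exists n => // j jl.
apply: He => i; rewrite iter_direct_product; apply: lt_trans (Hn i j jl) _.
by apply: le_lt_trans k0e; rewrite lef_pV2 ?posrE ?ltr0n// ler_nat.
Unshelve. all: by end_near. Qed.

(* A non-periodic point that returns to each of its neighbourhoods also
   returns to those avoiding any finite part of its orbit. *)
Lemma positive_return_recurrent (Y : topologicalType) (g : Y -> Y) y :
  accessible_space Y ->
  (forall U, nbhs y U -> exists2 n, (0 < n)%N & U (iter n g y)) ->
  recurrent_point g y.
Proof.
move=> aY ry U yU /finite_seqP[s Us].
have Us_le n : U (iter n g y) -> (n <= \max_(m <- s) m)%N.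
  move=> Un; apply: (@leq_bigmax_seq _ s predT id) => //.
  by have : return_set g y U n by []; rewrite Us.
have [[p p0 yp]|np] := pselect (exists2 p, (0 < p)%N & iter p g y = y).
  have ypM m : iter (m * p) g y = y.
    by elim: m => // m IH; rewrite mulSn iterD IH yp.
  (* A periodic point returns at a multiple of [p] beyond the maximum of the supposedly finite
     return set. *)
  have := Us_le ((\max_(m <- s) m).+1 * p)%N; rewrite ypM => /(_ (nbhs_singleton yU)).
  by rewrite leqNgt (leq_trans (ltnSn _))// leq_pmulr.
have [|n n0 [/Us_le nM Hn]] := ry (U `&`
    [set z | forall i : 'I_(\max_(m <- s) m), z <> iter i.+1 g y]).
  apply: filterI => //; apply: filter_forall => i.
  apply: open_nbhs_nbhs; split.
    rewrite -closedC (_ : ~` _ = [set iter i.+1 g y]).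
      exact: accessible_closed_set1.
    by apply/seteqP; split => z /=; [exact: contrapT|move=> -> /(_ erefl)].
  by move=> yi; apply: np; exists i.+1.
by case: n n0 nM Hn => // n _ nM /(_ (Ordinal nM)); exact.
Qed.

Lemma point_recurrent_of_returns (R : realType) (X : metricType R) (f : X -> X) N :
  complete_space X -> continuous f ->
  (forall (Us : seq (set X)), (forall U, U \in Us -> open U /\ U !=set0) ->
    exists2 n, (0 < n)%N & forall U, U \in Us ->
      exists x, forall j, (j <= 1)%N -> U (iter (j * n) f x)) ->
  point_recurrent {ptws 'I_N -> X} (direct_product f (N := N)).
Proof.
move=> complete_X cf joint O O0 oO.
have [y [Oy Hy]] := product_returns_dense (l := fun=> 1%N) complete_X cf (fun=> joint) O0 oO.
exists y; split=> //; apply: positive_return_recurrent.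
  apply: hausdorff_accessible; apply: (@hausdorff_product _ (fun=> X)) => _.
  exact: metric_hausdorff.
move=> U /Hy[k /(_ k (leqnn k))[n n0 Hn]]; exists n => //.
by have := Hn 1%N isT; rewrite mul1n.
Qed.

Lemma AP_recurrent_of_returns (R : realType) (X : metricType R) (f : X -> X) N :
  complete_space X -> continuous f ->
  (forall k (Us : seq (set X)), (forall U, U \in Us -> open U /\ U !=set0) ->
    exists2 n, (0 < n)%N & forall U, U \in Us ->
      exists x, forall j, (j <= k)%N -> U (iter (j * n) f x)) ->
  AP_recurrent {ptws 'I_N -> X} (direct_product f (N := N)).
Proof.
move=> complete_X cf joint O O0 oO.
have [y [Oy Hy]] := product_returns_dense (l := id) complete_X cf joint O0 oO.
exists y; split=> // U /Hy[k Hk] l _.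
(* Stage [maxn k l] is late enough for the neighbourhood and long enough for the progression. *)
have [n n0 Hn] := Hk (maxn k l) (leq_maxl k l); exists n, 0%N; split=> // j jl.
by apply: Hn; rewrite leq_max jl orbT.
Qed.

(** * The Vietoris topology and finite sets *)

(** Lists the sets as a family and picks a point in each: the finite set of these points then lies
    in [vietoris Us]. Non-emptiness of [Us] accounts for [N.+1]. *)
Lemma vietoris_indexP (X : topologicalType) (Us : set (set X)) :
  vietoris_index Us -> exists N (U : 'I_N.+1 -> set X) (y : 'I_N.+1 -> X),
    Us = range U /\ forall i, U i (y i).
Proof.
move=> [/finite_seqP[s ->]]; case: s => [|U0 s] s0 oUs; first by case: s0.
have sP i : (i < (size s).+1)%N -> nth U0 (U0 :: s) i \in U0 :: s.
  by move=> ?; exact: mem_nth.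
have /choice[y Uy] (i : 'I_(size s).+1) : exists x, nth U0 (U0 :: s) i x.
  by have [] := oUs _ (sP _ (ltn_ord i)).
exists (size s), (fun i : 'I__ => nth U0 (U0 :: s) i), y; split=> //.
apply/seteqP; split=> [U /= /(nthP U0)[i il <-]|_ [i _ <-]].
  by exists (Ordinal il).
exact: sP (ltn_ord i).
Qed.

Lemma open_vietoris (X : topologicalType) (Us : set (set X)) :
  vietoris_index Us -> open (vietoris Us).
Proof.
by move=> vUs; exists [set Us]; [move=> _ ->|rewrite bigcup_set1].
Qed.

Lemma nbhs_vietoris (X : topologicalType) (K : hyperspace X) O :
  nbhs K O -> exists Us, [/\ vietoris_index Us, vietoris Us K &
    vietoris Us `<=` O].
Proof.
rewrite nbhsE => -[B [[D Dv <-] [Us DUs KUs]] BO].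
exists Us; split=> //; first exact: Dv.
by move=> L LUs; apply: BO; exists Us.
Qed.

Lemma hyperspace_eq (X : topologicalType) (K L : hyperspace X) :
  (K : set X) = L -> K = L.
Proof.
case: K L => [K cK K0] [L cL L0] /= KL; subst L.
by congr Hyperspace; exact: Prop_irrelevance.
Qed.

Section finite_hyperspace.
Variables (X : topologicalType) (f : X -> X) (cf : continuous f).

Definition range_hyperspace N (y : {ptws 'I_N.+1 -> X}) : hyperspace X :=
  Hyperspace (finite_compact (finite_image y (@finite_finset _ setT)))
    (image_nonempty y (ex_intro setT ord0 I)).

Lemma range_hyperspace_continuous N : continuous (@range_hyperspace N).
Proof.
move=> y O /nbhs_vietoris[Us [vUs [yUs Usy] UsO]].
have [M [U [_ [UsE _]]]] := vietoris_indexP vUs.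
have oU j : open (U j).
  by case: vUs => _ _ /(_ (U j))[]; rewrite ?UsE//; exists j.
(* The coordinate [z i] is kept in all the [U j] that contain [y i], so every membership used for
   [y] survives. *)
apply/product_nbhsP; exists (fun i => [set z | forall j, U j (y i) -> U j z]).
  move=> i; apply: filter_forall => j.
  have [Uj|nUj] := pselect (U j (y i)); last exact: nearW.
  by apply: filterS (open_nbhs_nbhs (conj (oU j) Uj)).
move=> z Hz; apply: UsO; split.
  move=> _ [i _ <-]; have [|V + Vy] := yUs (y i); first by exists i.
  by rewrite UsE => -[j _ Uj]; subst V; exists (U j); [exists j|exact: Hz].
rewrite UsE => _ [j _ <-]; have [|_ [[i _ <-] Uy]] := Usy (U j).
  by rewrite UsE; exists j.
by exists (z i); split; [exists i|exact: Hz].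
Qed.

Lemma iter_hyper_map n (K : hyperspace X) :
  iter n (hyper_map cf) K = iter n f @` K :> set X.
Proof.
elim: n => [|n IH]; first by rewrite /= image_id.
by rewrite /= IH image_comp.
Qed.

Lemma hyper_map_returns l : progression_return (hyper_map cf) l ->
  forall Us, @vietoris_index X Us -> exists n (K : set X), (0 < n)%N /\
    forall j, (j <= l)%N -> iter (j * n) f @` K `<=` \bigcup_(U in Us) U /\
      forall U, Us U -> (iter (j * n) f @` K) `&` U !=set0.
Proof.
move=> ret Us vUs; have [N [U [y [UsE Uy]]]] := vietoris_indexP vUs.
have [|n [K [n0 Kn]]] := ret _ (open_vietoris vUs).
  exists (range_hyperspace y); rewrite UsE; split.
    by move=> _ [i _ <-]; exists (U i) => //; exists i.
  by move=> _ [i _ <-]; exists (y i); split => //; exists i.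
by exists n, K; split=> // j jl; rewrite -iter_hyper_map; exact: Kn.
Qed.

End finite_hyperspace.

(** * Fuzzy sets of finite support *)

Section point_fuzzy.
Variables (R : realType) (X : metricType R) (N : nat).
Implicit Types (y z : {ptws 'I_N.+1 -> X}) (w : 'I_N.+1 -> R).

Definition point_fuzzy_fun w y x : R :=
  \big[Num.max/0]_(i < N.+1 | y i == x) w i.

(** Positive weights make the support the set of all [y i]; a weight 1 gives normality. *)
Definition weights w := (forall i, 0 < w i <= 1) /\ exists i, w i = 1.

Lemma point_fuzzy_geP w y a x : 0 < a ->
  a <= point_fuzzy_fun w y x <-> exists2 i, y i = x & a <= w i.
Proof.
move=> a0; rewrite /point_fuzzy_fun; split.
  move=> /bigmax_geP[|[i /eqP yi ai]]; first by rewrite leNgt a0.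
  by exists i.
by move=> [i /eqP yi ai]; apply/bigmax_geP; right; exists i.
Qed.

Let closed_image y (I : set 'I_N.+1) : closed (y @` I).
Proof.
apply: compact_closed; first exact: metric_hausdorff.
by apply: finite_compact; exact: finite_image.
Qed.

Lemma level_point_fuzzy w y a : weights w -> 0 <= a ->
  level (point_fuzzy_fun w y) a = y @` [set i | a <= w i].
Proof.
move=> [w01 _]; rewrite /level le_eqVlt => /predU1P[<-|a0].
  (* At level 0 the closure adds nothing to a finite set, and [0 <= w i] selects every [i]. *)
  rewrite eqxx [X in closure X = _](_ : _ = y @` [set i | 0 <= w i]).
    by apply/esym/closure_id; exact: closed_image.
  apply/seteqP; split=> [x /= x0|_ [i _ <-]].
    have [i yi _] := (point_fuzzy_geP w y x x0).1 (lexx _).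
    by exists i => //=; apply: ltW; case/andP: (w01 i).
  have /andP[wi0 _] := w01 i.
  by apply: lt_le_trans wi0 _; apply/point_fuzzy_geP; [case/andP: (w01 i)|exists i].
rewrite gt_eqF//; apply/seteqP; split=> [x /= /(point_fuzzy_geP _ _ _ a0)[i yi wi]|].
  by exists i.
by move=> x [i wi yi]; apply/(point_fuzzy_geP _ _ _ a0); exists i.
Qed.

Variables (w : 'I_N.+1 -> R) (ww : weights w).

Let point_fuzzy_itv y x : 0 <= point_fuzzy_fun w y x <= 1.
Proof.
apply/andP; split; first exact: bigmax_ge_id.
by apply/bigmax_leP; split=> // i _; case/andP: (ww.1 i).
Qed.

Let point_fuzzy_usc y : upper_semicontinuous (point_fuzzy_fun w y).
Proof.
move=> x a xa.
have a0 : 0 < a by apply: le_lt_trans xa; case/andP: (point_fuzzy_itv y x).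
have nbE : [set z | point_fuzzy_fun w y z < a] = ~` (y @` [set i | a <= w i]).
  rewrite -(level_point_fuzzy y ww (ltW a0)) /level gt_eqF//.
  by apply/seteqP; split=> z /=; rewrite ltNge => /negP.
change (nbhs x [set z | point_fuzzy_fun w y z < a]).
apply: open_nbhs_nbhs; split=> //; rewrite nbE openC; exact: closed_image.
Qed.

Let point_fuzzy_compact y : compact (level (point_fuzzy_fun w y) 0).
Proof.
by rewrite level_point_fuzzy//; apply: finite_compact; exact: finite_image.
Qed.

Let point_fuzzy_normal y : level (point_fuzzy_fun w y) 1 !=set0.
Proof.
by have [i wi] := ww.2; rewrite level_point_fuzzy//; exists (y i), i; rewrite /= ?wi.
Qed.

Definition point_fuzzy y : fuzzy X := Fuzzy (point_fuzzy_itv y)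
  (@point_fuzzy_usc y) (@point_fuzzy_compact y) (point_fuzzy_normal y).

(** Both sides are compared through their positive lower bounds, which determine a non-negative real
    and are known for either construction. *)
Lemma zadeh_point_fuzzy (f : X -> X) (cf : continuous f) y :
  point_fuzzy (direct_product f y) = zadeh cf (point_fuzzy y).
Proof.
have le_eq (r s : R) : 0 <= r -> 0 <= s ->
    (forall a, 0 < a -> a <= r <-> a <= s) -> r = s.
  move=> r0 s0 rs; apply/eqP; rewrite eq_le; apply/andP; split.
    by have [r1|/le_trans->//] := ltP 0 r; exact: (rs r r1).1.
  by have [s1|/le_trans->//] := ltP 0 s; exact: (rs s s1).2.
apply: fuzzy_eq => x; apply: le_eq; [exact: fuzzy_ge0|exact: fuzzy_ge0|].
move=> a a0.
change (a <= point_fuzzy_fun w (direct_product f y) x <->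
  a <= zadeh_fun f (point_fuzzy y) x).
split.
  move=> /(point_fuzzy_geP w _ x a0)[i yi wi]; apply/(zadeh_ge cf _ x a0).
  by exists (y i) => //; apply/(point_fuzzy_geP w y _ a0); exists i.
move=> /(zadeh_ge cf _ x a0)[z fz /(point_fuzzy_geP w y z a0)[i yi wi]].
by apply/(point_fuzzy_geP w _ x a0); exists i => //; rewrite /direct_product yi.
Qed.

End point_fuzzy.

(** * The fuzzy metrics and the level 1 *)

Section fuzzy_distance.
Variables (R : realType) (X : metricType R).
Implicit Types u v : fuzzy X.

Let support u v : set X := level u 0 `|` level v 0.

Let bounded_support u v : bounded_diam (support u v).
Proof. by apply: compact_bounded_diam; apply: compactU; exact: fuzzy_compact. Qed.

Let levels_l u v : levels_in (support u v) u.
Proof. exact/fuzzy_levels_in/subsetUl. Qed.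

Let levels_r u v : levels_in (support u v) v.
Proof. exact/fuzzy_levels_in/subsetUr. Qed.

Lemma sup_dist_le_levels u v (e : R) : (forall a, a \in `[0, 1] ->
    (forall x, level u a x -> set_dist x (level v a) <= e) /\
    (forall x, level v a x -> set_dist x (level u a) <= e)) ->
  sup_dist u v <= e.
Proof.
move=> He; apply/(sup_distP (bounded_support u v) _ (@levels_l u v) (@levels_r u v)).
move=> a a01; have [[ua ua0] [va va0]] := (@levels_l u v a a01, @levels_r u v a a01).
exact/(hausdorff_distP (bounded_support u v) _ ua va ua0 va0)/He.
Qed.

Lemma increasing_homeo1 (xi : R -> R) : increasing_homeo xi -> xi 1 = 1.
Proof.
move=> [zeta [[xi01 ze01] [_ zeK] _ xi_lt]].
have I1 : (1 : R) \in `[0, 1] by rewrite bound_itvE.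
have := xi01 _ I1; have := ze01 _ I1; rewrite /= !in_itv /=.
move=> /andP[z0 z1] /andP[_ x1]; apply/eqP; rewrite eq_le x1 /=.
(* If [zeta 1 < 1], then [1 = xi (zeta 1) < xi 1]. *)
rewrite -{1}(zeK 1 I1); move: z1; rewrite le_eqVlt => /predU1P[->//|z1].
by apply/ltW/xi_lt => //; exact: ze01.
Qed.

Lemma skorokhod_dist_level1 u v (e : R) : skorokhod_dist u v < e ->
  (forall x, level u 1 x -> exists2 y, level v 1 y & mdist x y < e) /\
  (forall y, level v 1 y -> exists2 x, level u 1 x & mdist y x < e).
Proof.
have v01 x : v x \in `[0, 1] by rewrite in_itv /= fuzzy_itv.
move=> /inf_lt[|e' [xi [hxi _ uve]] ee'].
  (* The identity shows that the infimum is over a non-empty set. *)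
  exists (Num.max (sup [set `|id a - a| | a in `[0, 1]%classic]) (sup_dist u (id \o v))).
  by exists id; split; [exact: homeo_id|rewrite le_max lexx|rewrite le_max lexx orbT].
have I1 : (1 : R) \in `[0, 1] by rewrite bound_itvE.
have xl : level (xi \o v) 1 = level v 1.
  rewrite /level oner_eq0; apply/seteqP; split=> x /=; last first.
    move=> vx; have -> : v x = 1 by apply/eqP; rewrite eq_le vx fuzzy_le1.
    by rewrite increasing_homeo1.
  rewrite leNgt => xv; rewrite leNgt; apply: contra xv => vx.
  by rewrite -(increasing_homeo1 hxi); case: hxi => zeta [_ _ _]; apply.
have D := bounded_support u v.
have ul := @levels_l u v; have vl := homeo_levels_in v01 hxi (@levels_r u v).
have := le_sup_dist D ul vl I1; move=> /le_trans/(_ uve).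
have [[u1 u10] [v1 v10]] := (ul _ I1, vl _ I1).
move=> /(hausdorff_distP D _ u1 v1 u10 v10)[Hu Hv].
rewrite xl in Hu Hv v10; split=> x /= xl1.
  by apply: set_dist_lt => //; exact: le_lt_trans (Hu _ xl1) ee'.
by apply: set_dist_lt => //; exact: le_lt_trans (Hv _ xl1) ee'.
Qed.

Lemma level1_iter_zadeh (f : X -> X) (cf : continuous f) n u :
  level (iter n (zadeh cf) u) 1 = iter n f @` level u 1.
Proof.
elim: n => [|n IH]; first by rewrite /= image_id.
by rewrite iterS /= zadeh_level// IH image_comp.
Qed.

End fuzzy_distance.

(** The filter [F] on lists expresses that a property holds for all sufficiently large finite lists.
    Near each point a single centre suffices, and the near-covering form of compactness makes one
    list serve all of [A]. *)
Lemma compact_finite_net (R : realType) (X : metricType R) (A : set X) (r : R) :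
  compact A -> 0 < r -> exists s : seq X,
    forall x, A x -> exists2 c, c \in s & ball c r x.
Proof.
move=> cA r0; pose F : set_system (seq X) :=
  [set P | exists s : seq X, forall t : seq X, {subset s <= t} -> P t].
have FF : Filter F.
  split; first by exists [::].
    move=> P Q [s sP] [t tQ]; exists (s ++ t) => v stv; split.
      by apply: sP => x xs; apply: stv; rewrite mem_cat xs.
    by apply: tQ => x xt; apply: stv; rewrite mem_cat xt orbT.
  by move=> P Q PQ [s sP]; exists s => t /sP/PQ.
move/compact_near_coveringP : cA.
move=> /(_ _ F (fun s x => exists2 c, c \in s & ball c r x) FF)[|s Hs].
  move=> x _; exists (ball x r, [set s | x \in s]) => /=.
    split; first exact: nbhsx_ballx.
    by exists [:: x] => t; apply; exact: mem_head.
  by case=> z s /= [xz xs]; exists x.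
by exists s => x Ax; exact: Hs.
Qed.

(** * Returns of the Zadeh extension and continuity of finite fuzzy sets *)

Section fuzzy_returns.
Variables (R : realType) (X : metricType R) (f : X -> X) (cf : continuous f).

Lemma zadeh_returns l :
  progression_return (zadeh cf : fuzzy_skorokhod X -> fuzzy_skorokhod X) l ->
  forall Us, @vietoris_index X Us -> exists n (K : set X), (0 < n)%N /\
    forall j, (j <= l)%N -> iter (j * n) f @` K `<=` \bigcup_(U in Us) U /\
      forall U, Us U -> (iter (j * n) f @` K) `&` U !=set0.
Proof.
move=> ret Us vUs; have [N [U [y [UsE Uy]]]] := vietoris_indexP vUs.
have yU i : nbhs (y i) (U i).
  apply: open_nbhs_nbhs; split=> //.
  have [_ _ oU] := vUs; have [|//] := oU (U i).
  by rewrite UsE; exists i.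
have [e e0 He] := uniform_radius yU.
(* With all weights 1, [u] is the characteristic function of the finite set of the [y i]. *)
have w1 : weights (fun _ : 'I_N.+1 => 1 : R).
  by split=> [i|]; [rewrite ltr01 lexx|exists ord0].
pose u : fuzzy_skorokhod X := point_fuzzy w1 y.
have u1 : level (point_fuzzy w1 y) 1 = range y.
  by rewrite level_point_fuzzy//; apply/seteqP; split=> _ [i _ <-]; exists i; rewrite /= ?lexx.
have [||n [v [n0 vn]]] := ret (interior (ball u e)).
- exact: open_interior.
- by exists u; exact: nbhsx_ballx.
exists n, (level (v : fuzzy X) 1); split=> // j jl.
rewrite -(level1_iter_zadeh cf).
have := interior_subset (vn j jl); rewrite ballEmdist /=.
move=> /skorokhod_dist_level1[Hu Hv]; rewrite u1 in Hu Hv; rewrite UsE; split.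
  move=> z /Hv[_ [i _ <-]]; rewrite metric_sym => zi; exists (U i); first by exists i.
  by apply: He; rewrite ballEmdist.
move=> _ [i _ <-]; have [|z vz yz] := Hu (y i); first by exists i.
by exists z; split=> //; apply: He; rewrite ballEmdist.
Qed.

(** For fixed weights, the levels of two such fuzzy sets use the same indices, so they are as close
    as the coordinates. The radius [e / 2] absorbs the non-strict bound on the supremum. *)
Lemma point_fuzzy_continuous N (w : 'I_N.+1 -> R) (ww : weights w) :
  continuous (point_fuzzy ww : {ptws 'I_N.+1 -> X} -> fuzzy_infty X).
Proof.
move=> y O /nbhs_ballP[e /= e0 eO]; have e20 : 0 < e / 2 by rewrite divr_gt0.
apply/product_nbhsP; exists (fun i => ball (y i) (e / 2)).
  by move=> i; exact: nbhsx_ballx.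
move=> z yz; apply: eO; rewrite ballEmdist /=.
apply: (@le_lt_trans _ _ (e / 2)); last by rewrite gtr_pMr// invf_lt1// ltr1n.
apply: sup_dist_le_levels => a; rewrite in_itv /= => /andP[a0 _].
rewrite !level_point_fuzzy//; split=> _ [i ai <-].
  have zi : (z @` [set i | a <= w i]) (z i) by exists i.
  apply: (le_trans (set_dist_le _ zi)).
  by have := yz i; rewrite ballEmdist => /ltW.
have yi : (y @` [set i | a <= w i]) (y i) by exists i.
apply: (le_trans (set_dist_le _ yi)); rewrite metric_sym.
by have := yz i; rewrite ballEmdist => /ltW.
Qed.

End fuzzy_returns.

(** * Density of the fuzzy sets of finite support *)

Section fuzzy_net.
Variables (R : realType) (X : metricType R) (u : fuzzy X).

(** If the supremum [M] were not attained, upper semicontinuity would bound [u] away from [M] near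
    each point, and compactness would give a uniform bound [M - e] on [A]. *)
Lemma fuzzy_attains_max A : compact A -> A !=set0 ->
  exists2 m, A m & forall x, A x -> u x <= u m.
Proof.
move=> cA [x0 Ax0]; pose M := sup (u @` A).
have ubA : has_ubound (u @` A) by exists 1 => _ [x _ <-]; exact: fuzzy_le1.
have uM x : A x -> u x <= M by move=> Ax; apply: ub_le_sup => //; exists x.
have [[m [Am Mm]]|nM] := pselect (exists m, A m /\ M <= u m).
  by exists m => // x /uM/le_trans; apply.
have ltM x : A x -> u x < M.
  by move=> Ax; rewrite ltNge; apply/negP => ?; apply: nM; exists x.
have He : \forall e \near 0^'+, A `<=` [set x | u x <= M - e].
  move/compact_near_coveringP : cA; apply => x /ltM xM.
  have [xc cM] : u x < (u x + M) / 2 /\ (u x + M) / 2 < M by rewrite !midf_lt.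
  exists ([set z | u z < (u x + M) / 2], [set e | e <= M - (u x + M) / 2]) => /=.
    split; first exact: fuzzy_usc.
    by apply: nbhs_right_le; rewrite subr_gt0.
  by case=> z e /= [zc ec]; apply: (le_trans (ltW zc)); lra.
near (0 : R)^'+ => e.
have e0 : 0 < e by near: e; exact: nbhs_right_gt.
have Ae : A `<=` [set x | u x <= M - e] by near: e.
have : M <= M - e.
  by apply: ge_sup; [exists (u x0), x0|move=> _ [x /Ae + <-]].
by rewrite leNgt ltrBlDr ltrDl e0.
Unshelve. all: by end_near. Qed.

(* Taking for [s] the points where [u] is maximal on small pieces of its
   support, rather than any net, makes the approximation uniform in the level. *)
Lemma fuzzy_net (r : R) : 0 < r -> exists s : seq X,
  (forall c, c \in s -> 0 < u c) /\
  forall x, 0 < u x -> exists c, [/\ c \in s, u x <= u c & mdist x c < r *+ 3].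
Proof.
move=> r0.
have /choice[m Hm] (c : X) : exists m, forall x, level u 0 x -> ball c r x ->
    u x <= u m /\ mdist x m < r *+ 3.
  (* The ball is closed up so that the maximum is attained; if the piece misses the support, any [m]
     will do. *)
  have [B0|nB] := pselect (level u 0 `&` closure (ball c r) !=set0); last first.
    by exists c => x ux cx; case: nB; exists x; split=> //; exact: subset_closure.
  have cB : compact (level u 0 `&` closure (ball c r)).
    apply: (subclosed_compact _ (@fuzzy_compact _ _ u) (@subIsetl _ _ _)).
    by apply: closedI; [rewrite /level eqxx|]; exact: closed_closure.
  have [m [_ cm] Hm] := fuzzy_attains_max cB B0; exists m => x ux cx; split.
    by apply: Hm; split=> //; exact: subset_closure.
  (* [m] is only in the closure of the ball; a point [z] of the ball near [m] costs the third
     [r]. *)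
  have [z []] := cm _ (nbhsx_ballx _ _ r0).
  rewrite !ballEmdist /= => cz mz; move: cx; rewrite ballEmdist /= => cx.
  rewrite (le_lt_trans (metric_triangle _ c _))// mulrS ltrD//.
    by rewrite metric_sym.
  rewrite (le_lt_trans (metric_triangle _ z _))// mulr2n ltrD//.
  by rewrite metric_sym.
have [D HD] := compact_finite_net (@fuzzy_compact _ _ u) r0.
(* The filter loses nothing: a maximal point serving some [x] with [0 < u x] has
   [u x <= u (m c)]. *)
exists [seq c <- [seq m c | c <- D] | 0 < u c]; split.
  by move=> c; rewrite mem_filter => /andP[].
move=> x x0; have ux : level u 0 x by rewrite /level eqxx; exact: subset_closure.
have [c cD cx] := HD x ux.
have [xm dm] := Hm c x ux cx; exists (m c); split=> //.
by rewrite mem_filter (lt_le_trans x0 xm); apply: map_f.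
Qed.

Lemma point_fuzzy_dense (e : R) : 0 < e -> exists N (w : 'I_N.+1 -> R)
  (ww : weights w) (y : {ptws 'I_N.+1 -> X}), sup_dist u (point_fuzzy ww y) < e.
Proof.
(* The net costs [r *+ 3] and the closure at level 0 another [r], and [r *+ 4 < e]. *)
move=> e0; pose r := e / 5%:R; have r0 : 0 < r by rewrite divr_gt0.
have [s [s0 Hs]] := fuzzy_net r0.
have [x1] := fuzzy_normal u; rewrite /level oner_eq0 /= => ux1.
have [c1 [c1s u1c1 _]] := Hs x1 (lt_le_trans ltr01 ux1).
case: s s0 Hs c1s => // c s s0 Hs c1s.
pose y : {ptws 'I_(size s).+1 -> X} := fun i => nth c (c :: s) i.
have ys i : y i \in c :: s by exact: mem_nth.
have sy z : z \in c :: s -> exists i, y i = z.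
  by move=> /(nthP c)[i il <-]; exists (Ordinal il).
(* These weights put each level of the approximation inside that of [u], so one half of the
   Hausdorff distance vanishes. *)
pose w i := u (y i).
have ww : weights w.
  split=> [i|]; first by rewrite /w s0 ?fuzzy_le1.
  have [i yi] := sy _ c1s; exists i; apply/eqP.
  by rewrite eq_le fuzzy_le1 /w yi (le_trans ux1).
exists (size s), w, ww, y; apply: (@le_lt_trans _ _ (r *+ 4)); last first.
  by rewrite -mulr_natr /r; lra.
apply: (@sup_dist_le_levels _ _ u (point_fuzzy ww y)) => a; rewrite in_itv /= => /andP[a0 a1].
rewrite level_point_fuzzy//; split=> [x xa|_ [i ai <-]]; last first.
  rewrite set_dist_self ?mulrn_wge0 ?ltW//; rewrite /level; case: ifPn => // _.
  by apply: subset_closure; exact: s0.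
have [x' [ux' ax' xx']] : exists x', [/\ 0 < u x', a <= u x' & mdist x x' < r].
  move: xa; rewrite /level; case: ifPn => [/eqP -> cx|an0 /= ax].
    have [x' [ux']] := cx _ (nbhsx_ballx _ _ r0).
    by rewrite ballEmdist /= => xx'; exists x'; rewrite ltW.
  exists x; rewrite mdistxx; split=> //; apply: lt_le_trans ax.
  by rewrite lt_neqAle eq_sym an0.
have [z [zs uz dz]] := Hs x' ux'; have [i yi] := sy _ zs.
have Az : (y @` [set i | a <= w i]) z.
  by exists i; rewrite //= /w yi (le_trans ax').
apply: (le_trans (set_dist_le _ Az)).
by rewrite (le_trans (metric_triangle _ x' _))// mulrS lerD// ltW.
Qed.

End fuzzy_net.

(* [P Y g] stands for either of the two recurrence properties of [g]. *)
Definition factor_family (P : forall Y : topologicalType, (Y -> Y) -> Prop)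
    (Z : topologicalType) (h : Z -> Z) :=
  forall O : set Z, O !=set0 -> open O ->
    exists (Y : topologicalType) (g : Y -> Y) (phi : Y -> Z),
      [/\ P Y g, continuous phi, forall y, phi (g y) = h (phi y) &
          phi @^-1` O !=set0].

(** * Transfer of recurrence along factor maps *)

Section factors.
Variables (Y Z : topologicalType) (g : Y -> Y) (h : Z -> Z) (phi : Y -> Z).
Hypothesis cphi : continuous phi.
Hypothesis phiE : forall y, phi (g y) = h (phi y).

Lemma return_set_factor y U :
  return_set h (phi y) U = return_set g y (phi @^-1` U).
Proof.
rewrite /return_set; apply/funext => n /=; congr U.
by elim: n => //= n ->; rewrite phiE.
Qed.

Lemma recurrent_point_factor y : recurrent_point g y -> recurrent_point h (phi y).
Proof. by move=> ry U /cphi/ry; rewrite return_set_factor. Qed.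

Lemma AP_recurrent_point_factor y :
  AP_recurrent_point g y -> AP_recurrent_point h (phi y).
Proof. by move=> ry U /cphi/ry; rewrite return_set_factor. Qed.

End factors.

(** A recurrent point in the preimage of [O] is mapped to one in [O]. The factor map may vary with
    [O], as density is tested on one open set at a time. *)
Lemma point_recurrent_factors (Z : topologicalType) (h : Z -> Z) :
  factor_family point_recurrent h -> point_recurrent Z h.
Proof.
move=> fac O O0 oO; have [Y [g [phi [rg cphi phiE phiO]]]] := fac O O0 oO.
have [|y [yO ry]] := rg _ phiO; first by apply: open_comp => // y _; exact: cphi.
by exists (phi y); split=> //; exact: (recurrent_point_factor cphi phiE).
Qed.

Lemma AP_recurrent_factors (Z : topologicalType) (h : Z -> Z) :
  factor_family AP_recurrent h -> AP_recurrent Z h.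
Proof.
move=> fac O O0 oO; have [Y [g [phi [rg cphi phiE phiO]]]] := fac O O0 oO.
have [|y [yO ry]] := rg _ phiO; first by apply: open_comp => // y _; exact: cphi.
by exists (phi y); split=> //; exact: (AP_recurrent_point_factor cphi phiE).
Qed.

(** * The cycle of implications *)

Section recurrence_equivalence.
Variable P : forall Y : topologicalType, (Y -> Y) -> Prop.
Variables (R : realType) (X : metricType R) (f : X -> X) (cf : continuous f).

Let products := forall N : nat, (0 < N)%N ->
  P (direct_product f (N := N) : {ptws 'I_N -> X} -> {ptws 'I_N -> X}).

Lemma hyperspace_factors : products -> factor_family P (hyper_map cf).
Proof.
move=> prodP O [K OK] oO.
have [Us [vUs KUs UsO]] := nbhs_vietoris (open_nbhs_nbhs (conj oO OK)).
have [N [U [y [UsE Uy]]]] := vietoris_indexP vUs.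
exists {ptws 'I_N.+1 -> X}, (direct_product f (N := N.+1)), (@range_hyperspace X N).
split; [exact: prodP|exact: range_hyperspace_continuous| |].
  move=> z; apply: hyperspace_eq => /=; apply/seteqP; split=> [_ [i _ <-]|].
    by exists (z i) => //; exists i.
  by move=> _ [_ [i _ <-] <-]; exists i.
exists y; apply: UsO; rewrite UsE; split.
  by move=> _ [i _ <-]; exists (U i) => //; exists i.
by move=> _ [i _ <-]; exists (y i); split => //; exists i.
Qed.

Lemma fuzzy_infty_factors : products ->
  factor_family P (zadeh cf : fuzzy_infty X -> fuzzy_infty X).
Proof.
move=> prodP O [u Ou] oO.
have /nbhs_ballP[e /= e0 eO] := open_nbhs_nbhs (conj oO Ou).
have [N [w [ww [y uy]]]] := point_fuzzy_dense (u : fuzzy X) e0.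
exists {ptws 'I_N.+1 -> X}, (direct_product f (N := N.+1)), (point_fuzzy ww).
split; [exact: prodP|exact: point_fuzzy_continuous| |].
  by move=> z; exact: zadeh_point_fuzzy.
by exists y; apply: eO; rewrite ballEmdist.
Qed.

Lemma fuzzy_skorokhod_factors :
  P (zadeh cf : fuzzy_infty X -> fuzzy_infty X) ->
  factor_family P (zadeh cf : fuzzy_skorokhod X -> fuzzy_skorokhod X).
Proof.
move=> Pz O [u Ou] oO.
exists (fuzzy_infty X), (zadeh cf), (fun v => v); split=> //; last by exists u.
move=> v A /nbhs_ballP[e /= e0 eA]; apply/nbhs_ballP; exists e => //= z.
rewrite ballEmdist /= => vz; apply: eA; rewrite ballEmdist /=.
by apply: le_lt_trans vz; exact: skorokhod_dist_le.
Qed.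

Variable l : nat -> nat.
Hypothesis P_factors : forall (Z : topologicalType) (h : Z -> Z),
  factor_family P h -> P h.
Hypothesis P_return : forall (Y : topologicalType) (g : Y -> Y) k,
  P g -> progression_return g (l k).
Hypothesis joint_P : (forall k (Us : seq (set X)),
    (forall U, U \in Us -> open U /\ U !=set0) ->
    exists2 n, (0 < n)%N & forall U, U \in Us ->
      exists x, forall j, (j <= l k)%N -> U (iter (j * n) f x)) -> products.

Lemma recurrence_equivalence : [<-> products;
  P (hyper_map cf);
  P (zadeh cf : fuzzy_infty X -> fuzzy_infty X);
  P (zadeh cf : fuzzy_skorokhod X -> fuzzy_skorokhod X)].
Proof.
(* The step from the hyperspace to [fuzzy_infty X] passes through the products, since its factor
   maps start there. *)
have to_products : P (hyper_map cf) -> products.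
  move=> Ph; apply: joint_P => k; apply: joint_return => //.
  exact/hyper_map_returns/P_return.
tfae.
- by move=> /hyperspace_factors; exact: P_factors.
- by move=> /to_products/fuzzy_infty_factors; exact: P_factors.
- by move=> /fuzzy_skorokhod_factors; exact: P_factors.
- move=> Ps; apply: joint_P => k; apply: joint_return => //.
  exact/zadeh_returns/P_return.
Qed.

End recurrence_equivalence.

Theorem corollary5p1 (R : realType) (X : metricType R) (f : X -> X)
    (complete_X : complete_space X) (cont_f : continuous f) :
  [<-> (forall N : nat, (0 < N)%N ->
          point_recurrent {ptws 'I_N -> X} (direct_product f (N := N)));
       point_recurrent (hyperspace X) (hyper_map cont_f);
       point_recurrent (fuzzy_infty X) (zadeh cont_f);
       point_recurrent (fuzzy_skorokhod X) (zadeh cont_f)]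
  /\
  [<-> (forall N : nat, (0 < N)%N ->
          AP_recurrent {ptws 'I_N -> X} (direct_product f (N := N)));
       AP_recurrent (hyperspace X) (hyper_map cont_f);
       AP_recurrent (fuzzy_infty X) (zadeh cont_f);
       AP_recurrent (fuzzy_skorokhod X) (zadeh cont_f)].
Proof.
split.
- apply: (@recurrence_equivalence point_recurrent _ _ _ _ (fun=> 1%N)).
  + exact: point_recurrent_factors.
  + by move=> Y g _; exact: point_recurrent_return.
  + by move=> joint N _; apply: point_recurrent_of_returns => //; exact: joint 0%N.
(* With [id] the lengths grow along with the precision. *)
- apply: (@recurrence_equivalence AP_recurrent _ _ _ _ id).
  + exact: AP_recurrent_factors.
  + by move=> Y g k; exact: AP_recurrent_return.
  + by move=> joint N _; exact: AP_recurrent_of_returns.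
Qed.
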